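(* Let $\ell \ge -1$ and $r \ge 3$ be integers, and let $n$ be sufficiently large (in terms of $\ell$ and $r$). Let $G$ be an $n$-vertex, $K_{r+1}$-free graph with degrees $d_1 \le \cdots \le d_n$. If there is an integer $j$ with $1 \le j \le (n-1-\ell)/2$ such that $d_j \le j+\ell$, then, for all $t \ge 2$, \[ e(G) \leq e(G^{\ell *}_{n,r}) = e(T_r(n-1)) + (\ell+1) \quad\text{and}\quad k^t(G) \le k^t(G^{\ell *}_{n,r}).\] The bound is tight, as equality holds if $G \cong G^{\ell *}_{n,r}$; and if equality holds in the edge bound then $G \in \mathcal{G}^{\ell}_{n,r}$ or $G \in \mathcal{H}^{\ell}_{n,r}$.
   Context: Graphs are simple. $e(G)$ is the number of edges of $G$, and $k^t(G)$ is the number of $t$-cliques of $G$ (sets of $t$ pairwise adjacent vertices). $T_r(n)$ is the Turán graph: the $n$-vertex complete $r$-partite graph with parts as balanced as possible (so $T_r(n)=K_n$ if $n\le r$). For $-1 \le \ell \le \lfloor (r-1)n/r\rfloor - 1$, $G^{\ell *}_{n,r}$ is the $n$-vertex $r$-partite colex Turán graph with $m = e(T_r(n-1))+\ell+1$ edges: its vertex set is $\{1,\dots,n\}$ and its edges are the first $m$ pairs $\{i,j\}$ of positive integers with $i\not\equiv j \pmod r$ in colexicographic order ($A<_C B$ iff $\max(A\triangle B)\in B$). Equivalently, $\{1,\dots,n-1\}$ with classes mod $r$ forms $T_r(n-1)$ and vertex $n$ is adjacent to exactly the $\ell+1$ smallest $i<n$ with $i\not\equiv n \pmod r$ (vertex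 $n$ is isolated if $\ell=-1$). $\mathcal{G}^{\ell}_{n,r}$ is the set of $n$-vertex, $K_{r+1}$-free graphs consisting of $T_r(n-1)$ plus one additional vertex of degree $\ell+1$. $\mathcal{H}^{\ell}_{n,r}$ is the set of $n$-vertex, $K_{r+1}$-free graphs consisting of $T_r((n+1+\ell)/2)$ plus an independent set of $(n-1-\ell)/2$ additional vertices, each of degree $(n-1+\ell)/2$ (this set is empty when $n\equiv\ell \pmod 2$). *)

(* Defs.v *)
From mathcomp Require Import all_boot all_order all_algebra.
Set Implicit Arguments.
Unset Strict Implicit.
Unset Printing Implicit Defensive.
Import Order.TTheory GRing.Theory Num.Theory.

Record sgraph (V : finType) := SGraph {
  adj :> rel V;
  sg_sym : symmetric adj;
  sg_irr : irreflexive adj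
}.

Section Basic.
Variables (V : finType) (G : sgraph V).

Definition edges : {set {set V}} :=
  [set E | [exists x, exists y, G x y && (E == [set x; y])]].
Definition num_edges : nat := #|edges|.

Definition is_clique (A : {set V}) : bool :=
  [forall x in A, forall y in A, (x != y) ==> G x y].
Definition num_cliques (t : nat) : nat :=
  #|[set A : {set V} | is_clique A & #|A| == t]|.

Definition clique_free (k : nat) : Prop :=
  forall A : {set V}, is_clique A -> #|A| <> k.

Definition independent (A : {set V}) : bool :=
  [forall x in A, forall y in A, ~~ G x y].

Definition deg (x : V) : nat := #|[set y | G x y]|.

Definition degree_seq : seq nat := sort leq [seq deg x | x <- enum V].

(* Indexed from 1: sorted_deg j is d_j, where d_1 <= ... <= d_n; it is only
   meaningful for 1 <= j <= #|V|. *)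
Definition sorted_deg (j : nat) : nat := nth 0 degree_seq j.-1.

Definition induced_rel (A : {set V}) : rel {x | x \in A} :=
  fun x y => G (val x) (val y).
Fact induced_sym A : symmetric (@induced_rel A).
Proof. by move=> x y; apply: sg_sym. Qed.
Fact induced_irr A : irreflexive (@induced_rel A).
Proof. by move=> x; apply: sg_irr. Qed.
Definition induced (A : {set V}) : sgraph {x | x \in A} :=
  SGraph (@induced_sym A) (@induced_irr A).

End Basic.

Definition isomorphic (V W : finType) (G : sgraph V) (H : sgraph W) : Prop :=
  exists2 f : V -> W, bijective f & forall x y, H (f x) (f y) = G x y.

(* In the two graphs below, i : 'I_n plays the role of the vertex i + 1 of
   {1, ..., n}; congruences and comparisons are unaffected by the shift. *)

(* The residue classes mod r are the r parts, with sizes differing by at most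
   one (r > 0). *)
Definition turan_rel (r n : nat) : rel 'I_n := fun i j => i %% r != j %% r.
Fact turan_sym r n : symmetric (@turan_rel r n).
Proof. by move=> i j; rewrite /turan_rel eq_sym. Qed.
Fact turan_irr r n : irreflexive (@turan_rel r n).
Proof. by move=> i; rewrite /turan_rel eqxx. Qed.
Definition turan (r n : nat) : sgraph 'I_n :=
  SGraph (@turan_sym r n) (@turan_irr r n).

(* max (A symmetric-difference B) belongs to B. *)
Definition colex_lt (n : nat) (A B : {set 'I_n}) : bool :=
  [exists x in B :\: A, forall y in (A :\: B) :|: (B :\: A), y <= x].

(* {i, j} is one of the first m pairs of integers incongruent mod r iff fewer
   than m such pairs precede it. Every predecessor of a pair in {1, ..., n} lies
   in {1, ..., n}, so it suffices to count the pairs inside 'I_n; the graph has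
   exactly m edges as soon as m <= num_edges (turan r n). *)
Definition colex_turan_rel (r n m : nat) : rel 'I_n := fun i j =>
  turan r n i j &&
  (#|[set B in edges (turan r n) | colex_lt B [set i; j]]| < m).
Fact colex_turan_sym r n m : symmetric (@colex_turan_rel r n m).
Proof. by move=> i j; rewrite /colex_turan_rel sg_sym [[set i; j]]setUC. Qed.
Fact colex_turan_irr r n m : irreflexive (@colex_turan_rel r n m).
Proof. by move=> i; rewrite /colex_turan_rel sg_irr. Qed.
Definition colex_turan (r n m : nat) : sgraph 'I_n :=
  SGraph (@colex_turan_sym r n m) (@colex_turan_irr r n m).

Local Open Scope ring_scope.

(* The absolute value only converts l + 1 >= 0 to nat. *)
Definition Gstar (l : int) (n r : nat) : sgraph 'I_n :=
  colex_turan r n (num_edges (turan r n.-1) + `|(l + 1)%R|)%N.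

Definition Gfamily (l : int) (n r : nat) (V : finType) (G : sgraph V) : Prop :=
  [/\ #|V| = n, clique_free G r.+1
    & exists v : V, isomorphic (induced G [set~ v]) (turan r n.-1)
                    /\ (deg G v)%:Z = l + 1].

(* The halved quantities are stated doubled, which makes the family empty when
   n and l have the same parity. *)
Definition Hfamily (l : int) (n r : nat) (V : finType) (G : sgraph V) : Prop :=
  [/\ #|V| = n, clique_free G r.+1
    & exists (m : nat) (S : {set V}),
      [/\ 2 * m%:Z = n%:Z + 1 + l,
          isomorphic (induced G S) (turan r m),
          2 * #|~: S|%:Z = n%:Z - 1 - l,
          independent G (~: S)
        & forall v, v \in ~: S -> 2 * (deg G v)%:Z = n%:Z - 1 + l]].

Definition degree_condition (l : int) (n : nat) (V : finType) (G : sgraph V) :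
    Prop :=
  exists j : nat, [/\ (1 <= j)%N, 2 * j%:Z <= n%:Z - 1 - l
                    & (sorted_deg G j)%:Z <= j%:Z + l].

(* Main.v *)
Require Import Defs.
From mathcomp Require Import all_boot all_order all_algebra.
From mathcomp Require Import zify ring.
Import Order.TTheory GRing.Theory Num.Theory.

(** Write L = l + 1 and let S be a set of j vertices of degree at most j + l,
    as supplied by the degree condition. Deleting S leaves a K_{r+1}-free graph
    on n - j vertices, and each deleted vertex lies in at most as many t-cliques
    as its neighbourhood, a K_r-free graph on at most j + l vertices, has
    (t-1)-cliques. Zykov's theorem (the Turan graph maximises the number of
    t-cliques, [zykov]) bounds both contributions:
      k^t(G) <= k^t(T_r(n-j)) + j k^{t-1}(T_{r-1}(j+l)).

    For j = 1 the right-hand side is k^t of the colex Turan graph: its last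
    vertex is joined to l + 1 vertices which span a copy of T_{r-1}(l+1)
    ([k_in_colex_turan], [k_in_nbhd_top]). If the edge bound is attained, then
    G minus the vertex of small degree has as many edges as T_r(n-1), hence is
    isomorphic to it ([turan_unique]), and G belongs to the first family.

    For j >= 2 and n large the bound is already at most k^t(T_r(n-1)), strictly
    so for edges ([low_degree_set_bound]); hence equality in the edge bound
    forces j = 1. Going from T_r(n-j) to T_r(n-1) adds j - 1 vertices, and the
    vertex added to T_r(m) creates at least C(r-1,t-1) floor(m/r)^{t-1} cliques
    ([k_turan_add_ge]), while T_{r-1}(s) has at most
    C(r-1,t-1) (s/(r-1))^{t-1} cliques of size t - 1 ([k_turan_density]). After
    Jensen's inequality the comparison becomes linear; since j <= n/2 its
    leading terms compare 3(r-1) with 2r, so it holds for r >= 4. For r = 3 the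
    two are equal, and the argument covers every j except those with n - 2j
    bounded. In that window the triangles are settled by the exact value of a
    sum of squares ([triangles_lost_lt_gained]). For edges
    ([edges_half_low_degree]), either every vertex of S misses several vertices
    of its complement W, which saves edges because the degree sum over S counts
    twice the edges inside S; or some vertex of S is joined to almost all of W,
    so that W is almost triangle-free and has only about |W|^2/4 edges.

    The clique counts of Turan graphs are never computed. Everything rests on
    one recursion: if K is a clique of size q, a clique C outside K extends into
    K through the common neighbours of C in K. There are at most q - |C| of
    these if K is a maximum clique ([k_in_max_clique_union]), and at least
    q - |C| if each outside vertex misses at most one vertex of K, as happens
    for q consecutive vertices of a Turan graph
    ([k_in_near_complete_union]). *)

Set Implicit Arguments.
Unset Strict Implicit.
Unset Printing Implicit Defensive.

(** * Cliques inside a vertex set *)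

Section CliqueCount.
Variables (V : finType) (G : sgraph V).
Implicit Types (A B C K S W X : {set V}) (x y v : V).

Definition cliques_in A t : {set {set V}} :=
  [set X : {set V} | [&& X \subset A, is_clique G X & #|X| == t]].
(** The number k^t of the subgraph induced on A. Working inside subsets of a
    fixed vertex type keeps inductions on the vertex set free of subtypes. *)
Definition k_in A t : nat := #|cliques_in A t|.
Definition nbhd x : {set V} := [set y | G x y].

Lemma is_cliqueP A :
  reflect {in A &, forall x y, x != y -> G x y} (is_clique G A).
Proof.
apply: (iffP forall_inP) => [h x y xA yA xy | h x xA].
  by have /forall_inP/(_ _ yA)/implyP := h _ xA; apply.
by apply/forall_inP => y yA; apply/implyP; apply: h.
Qed.

Lemma is_cliqueS A B : A \subset B -> is_clique G B -> is_clique G A.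
Proof.
move=> /subsetP AB /is_cliqueP clB; apply/is_cliqueP => x y xA yA.
by apply: clB; apply: AB.
Qed.

Lemma is_clique0 : is_clique G set0.
Proof. by apply/is_cliqueP => x y; rewrite inE. Qed.

Lemma k_in_setT t : k_in setT t = num_cliques G t.
Proof. by apply: eq_card => X; rewrite !inE subsetT. Qed.

Lemma edges_cliques : edges G = [set X : {set V} | is_clique G X & #|X| == 2].
Proof.
apply/setP => X; rewrite !inE; apply/idP/idP.
  case/existsP => x /existsP[y /andP[xy /eqP->]].
  have nxy : x != y by apply: contraTneq xy => ->; rewrite sg_irr.
  rewrite cards2 nxy andbT; apply/is_cliqueP => a b.
  by rewrite !inE => /orP[] /eqP-> /orP[] /eqP->; rewrite ?eqxx // sg_sym.
case/andP => /is_cliqueP clX /cards2P[x [y [nxy eX]]].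
apply/existsP; exists x; apply/existsP; exists y.
by rewrite eX eqxx andbT clX // eX !inE eqxx ?orbT.
Qed.

Lemma num_edgesE : num_edges G = num_cliques G 2.
Proof. by rewrite /num_edges edges_cliques. Qed.

Lemma k_inS A B t : A \subset B -> k_in A t <= k_in B t.
Proof.
move=> AB; apply/subset_leq_card/subsetP => X; rewrite !inE.
by case/and3P => XA -> ->; rewrite (subset_trans XA AB).
Qed.

Lemma k_in0 A : k_in A 0 = 1.
Proof.
rewrite /k_in -(cards1 (set0 : {set V})); apply: eq_card => X; rewrite !inE.
rewrite cards_eq0; case: eqP => [->|]; last by rewrite !andbF.
by rewrite sub0set is_clique0.
Qed.

Lemma k_in1 A : k_in A 1 = #|A|.
Proof.
rewrite /k_in -(card_imset (mem A) (@set1_inj V)); apply: eq_card => X.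
rewrite !inE; apply/and3P/imsetP => [[XA _ /cards1P[x eX]] | [x xA ->]].
  by exists x => //; rewrite -sub1set -eX.
by rewrite sub1set cards1; split=> //; apply/is_cliqueP => a b /set1P-> /set1P->;
  rewrite eqxx.
Qed.

Lemma k_in_set0 t : k_in set0 t = (t == 0).
Proof.
case: t => [|t]; first by rewrite k_in0.
apply/eqP; rewrite cards_eq0; apply/eqP/setP => X; rewrite !inE subset0.
by case: eqP => // ->; rewrite cards0 andbF.
Qed.

(** Group the cliques X of the union by their trace C on B; the rest of X is an
    arbitrary set of t - |C| common neighbours of C in the clique K. *)
Lemma k_in_clique_union K B t : is_clique G K -> [disjoint K & B] ->
  k_in (K :|: B) t =
  \sum_(C : {set V} | [&& C \subset B, is_clique G C & #|C| <= t])
     'C(#|[set k in K | [forall c in C, G k c]]|, t - #|C|).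
Proof.
move=> clK dKB; rewrite /k_in -sum1_card.
rewrite (partition_big (fun X : {set V} => X :&: B)
  (fun C : {set V} => [&& C \subset B, is_clique G C & #|C| <= t])) /=; last first.
  move=> X; rewrite inE => /and3P[_ clX /eqP <-].
  by rewrite subsetIr (is_cliqueS (subsetIl _ _) clX) subset_leq_card ?subsetIl.
apply: eq_bigr => C /and3P[CB clC leCt]; rewrite -cards_draws sum1dep_card.
have dKC : [disjoint K & C] by apply: disjointWr CB dKB.
have KB0 : K :&: B = set0 by apply/eqP; rewrite setI_eq0.
set KC := [set k in K | _].
have KCK : KC \subset K by apply/subsetP => k; rewrite inE => /andP[].
have injU : {in [set D : {set V} | D \subset KC & #|D| == t - #|C|] &,
             injective (fun D : {set V} => D :|: C)}.
  move=> D D'; rewrite !inE => /andP[sD _] /andP[sD' _] /(congr1 (fun X => X :&: K)).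
  have CK0 : C :&: K = set0 by apply/eqP; rewrite setIC setI_eq0.
  rewrite !setIUl CK0 !setU0 (setIidPl _) ?(setIidPl _) //;
    by apply: subset_trans KCK.
rewrite -(card_in_imset injU); apply: eq_card => X; rewrite !inE.
apply/andP/imsetP => [[] | [D]].
  move=> /and3P[XKB clX /eqP cX] /eqP eXC.
  have cXK : #|X :&: K| + #|C| = t.
    rewrite -cX -eXC -(cardsID B X) addnC; congr (_ + _); apply: eq_card => x.
    rewrite !inE andbC; case xX : (x \in X); rewrite ?andbF ?andbT /=; last by [].
    have := subsetP XKB x xX; rewrite !inE.
    case xK: (x \in K) => /=; first by rewrite (disjointFr dKB xK).
    by move=> ->.
  exists (X :&: K).
    rewrite inE -cXK addnK eqxx andbT; apply/subsetP => x; rewrite !inE => /andP[xX xK].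
    rewrite xK; apply/forall_inP => c cC; move/is_cliqueP: clX; apply => //.
      by have := cC; rewrite -eXC inE => /andP[].
    by apply: contraTneq cC => <-; rewrite (disjointFr dKC xK).
  by rewrite -eXC -setIUr (setIidPl XKB).
rewrite inE => /andP[sD /eqP cD] ->{X}.
have sDK := subset_trans sD KCK.
have dDC : [disjoint D & C] by apply: disjointWl sDK dKC.
split; last first.
  rewrite setIUl (setIidPl CB) (_ : D :&: B = set0) ?set0U //.
  by apply/eqP; rewrite setI_eq0; apply: disjointWl dKB.
rewrite setUSS //= cardsU; move: (dDC); rewrite -setI_eq0 => /eqP->.
rewrite cards0 subn0 cD subnK // eqxx andbT.
have DC x y : x \in D -> y \in C -> G x y.
  by move=> xD yC; have := subsetP sD x xD; rewrite inE => /andP[_ /forall_inP]; apply.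
apply/is_cliqueP => x y; rewrite !inE => /orP[xD|xC] /orP[yD|yC] nxy.
- by move/is_cliqueP: clK; apply=> //; apply: (subsetP sDK).
- exact: DC.
- by rewrite sg_sym; apply: DC.
- by move/is_cliqueP: clC; apply.
Qed.

Lemma sum_cliques_by_size B t (F : nat -> nat) :
  \sum_(C : {set V} | [&& C \subset B, is_clique G C & #|C| <= t]) F #|C|
  = \sum_(s < t.+1) k_in B s * F s.
Proof.
rewrite (partition_big (fun C : {set V} => inord #|C| : 'I_t.+1) predT) //=.
apply: eq_bigr => s _; rewrite /k_in -sum1_card big_distrl /=.
apply: eq_big => [C | C].
  rewrite inE; case sCB: (C \subset B) => //=; case: (is_clique G C) => //=.
  have [le | gt] := leqP #|C| t; first by rewrite -val_eqE /= inordK.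
  by apply/esym/gtn_eqF; apply: leq_trans (ltn_ord s) gt.
by case/andP=> /and3P[_ _ le] /eqP <-; rewrite mul1n inordK.
Qed.

(** The common neighbours in K of a clique C of B form a clique with C, so by
    maximality there are at most |K| - |C| of them. *)
Lemma k_in_max_clique_union K B t :
  is_clique G K -> [disjoint K & B] ->
  (forall C, C \subset K :|: B -> is_clique G C -> #|C| <= #|K|) ->
  k_in (K :|: B) t <= \sum_(s < t.+1) k_in B s * 'C(#|K| - s, t - s).
Proof.
move=> clK dKB maxK; rewrite k_in_clique_union //.
rewrite -(sum_cliques_by_size B t (fun s => 'C(#|K| - s, t - s))).
apply: leq_sum => C /and3P[CB clC leCt]; apply: leq_bin2l.
set KC := [set k in K | _].
have dKC : [disjoint KC & C].
  by apply: disjointWl (disjointWr CB dKB); apply/subsetP => k; rewrite inE => /andP[].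
have: #|KC :|: C| <= #|K|.
  apply: maxK.
    by apply: setUSS => //; apply/subsetP => k; rewrite inE => /andP[].
  have DC x y : x \in KC -> y \in C -> G x y.
    by move=> xD yC; move: xD; rewrite inE => /andP[_ /forall_inP]; apply.
  apply/is_cliqueP => x y; rewrite !(in_setU) => /orP[xD|xC] /orP[yD|yC] nxy.
  - by move/is_cliqueP: clK; apply=> //; [move: xD|move: yD]; rewrite inE => /andP[].
  - exact: DC.
  - by rewrite sg_sym; apply: DC.
  - by move/is_cliqueP: clC; apply.
rewrite cardsU; move: (dKC); rewrite -setI_eq0 => /eqP->.
by rewrite cards0 subn0; lia.
Qed.

(** Each vertex of a clique C of B rules out at most one vertex of K, so C has at
    least |K| - |C| common neighbours there. *)
Lemma k_in_near_complete_union K B t :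
  is_clique G K -> [disjoint K & B] ->
  (forall c, c \in B -> {in K &, forall k k', ~~ G k c -> ~~ G k' c -> k = k'}) ->
  \sum_(s < t.+1) k_in B s * 'C(#|K| - s, t - s) <= k_in (K :|: B) t.
Proof.
move=> clK dKB missK; rewrite k_in_clique_union //.
rewrite -(sum_cliques_by_size B t (fun s => 'C(#|K| - s, t - s))).
apply: leq_sum => C /and3P[CB clC leCt]; apply: leq_bin2l.
set KC := [set k in K | _].
rewrite leq_subLR -(cardsID KC K) addnC; apply: leq_add; last first.
  by apply: subset_leq_card; rewrite subsetIr.
pose f k := if [pick c in C | ~~ G k c] is Some c then c else k.
have fP k : k \in K :\: KC -> f k \in C /\ ~~ G k (f k).
  rewrite !inE => /andP[+ kK]; rewrite kK /= /f.
  case: pickP => [c /andP[] // | none]; case/negP; apply/forall_inP => c cC.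
  by have := none c; rewrite cC /= => /negbFE.
have injf : {in K :\: KC &, injective f}.
  move=> k k' kD k'D; have [fC nG] := fP _ kD; have [_ nG'] := fP _ k'D => e.
  apply: (missK (f k)) => //; last (by rewrite e); first exact: (subsetP CB).
    by move: kD; rewrite inE => /andP[].
  by move: k'D; rewrite inE => /andP[].
rewrite -(card_in_imset injf); apply/subset_leq_card/subsetP => c /imsetP[k kD ->].
by have [] := fP _ kD.
Qed.

Lemma exists_max_clique A :
  exists2 K : {set V}, (K \subset A) && is_clique G K
    & forall C : {set V}, C \subset A -> is_clique G C -> #|C| <= #|K|.
Proof.
pose P K := (K \subset A) && is_clique G K.
have P0 : P set0 by rewrite /P sub0set is_clique0.
exists [arg max_(K > set0 | P K) #|K|].
  by case: arg_maxnP.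
by move=> C CA clC; case: arg_maxnP => // K _; apply; rewrite /P CA.
Qed.

Lemma k_in_setU1 v A t : v \notin A ->
  k_in (v |: A) t.+1 = k_in A t.+1 + k_in (A :&: nbhd v) t.
Proof.
move=> vA; rewrite {1}/k_in -(cardsID (cliques_in A t.+1)) addnC addnC; congr (_ + _).
  apply: eq_card => X; rewrite !inE andbC; case: (X \subset A) / idP => //= XA.
  by rewrite (subset_trans XA) ?subsetUr // andbb.
have injv : {in cliques_in (A :&: nbhd v) t &, injective (fun X => v |: X)}.
  move=> X Y; rewrite !inE !subsetI => /and3P[/andP[XA _] _ _] /and3P[/andP[YA _] _ _].
  move/(congr1 (fun X => X :\ v)); rewrite !setU1K //.
    by apply: contra vA; apply: (subsetP YA).
  by apply: contra vA; apply: (subsetP XA).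
rewrite /k_in -(card_in_imset injv); apply: eq_card => X; rewrite !inE.
apply/idP/imsetP => [/andP[nXA /and3P[XvA clX /eqP cX]] | [Y + ->]].
  have vX : v \in X.
    apply: contraNT nXA => vX; rewrite clX cX eqxx !andbT.
    apply/subsetP => x xX; have := subsetP XvA x xX; rewrite !inE => /orP[/eqP e|//].
    by rewrite -e xX in vX.
  exists (X :\ v); last by rewrite setD1K.
  rewrite !inE (is_cliqueS _ clX) ?subsetDl //=; apply/andP; split; last first.
    by have := cardsD1 v X; rewrite vX cX add1n => -[->].
  apply/subsetP => x; rewrite !inE => /andP[xv xX].
  have := subsetP XvA x xX; rewrite !inE (negPf xv) /= => -> /=.
  by move/is_cliqueP: clX; apply=> //; rewrite eq_sym.
rewrite !inE subsetI => /and3P[/andP[YA Yv] clY /eqP cY].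
have vY : v \notin Y by apply: contra vA; apply: (subsetP YA).
rewrite cardsU1 vY cY eqxx !andbT setUS //=.
have -> /= : (v |: Y \subset A) = false.
  by apply/negbTE; apply: contra vA => /subsetP; apply; rewrite !inE eqxx.
have nv y : y \in Y -> G v y by move/(subsetP Yv); rewrite inE.
apply/is_cliqueP => x y; rewrite !inE => /orP[/eqP->|xY] /orP[/eqP->|yY].
- by rewrite eqxx.
- by move=> _; apply: nv.
- by move=> _; rewrite sg_sym; apply: nv.
- by move/is_cliqueP: clY; apply.
Qed.

Lemma k_in_setD1 v A t : v \in A ->
  k_in A t.+1 = k_in (A :\ v) t.+1 + k_in (A :&: nbhd v) t.
Proof.
move=> vA; rewrite -{1}(setD1K vA) k_in_setU1 ?setD11 //; congr (_ + k_in _ _).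
apply/setP => x; rewrite !inE; case: eqP => //= ->.
by rewrite sg_irr andbF.
Qed.

(** Remove the vertices of S one at a time; each destroys at most the cliques
    through its full neighbourhood. *)
Lemma k_in_delete_set S W t :
  k_in (S :|: W) t.+1 <= k_in W t.+1 + \sum_(v in S) k_in (nbhd v) t.
Proof.
elim: {S}#|S| {-2}S (erefl #|S|) => [|m IH] S cS.
  by move/eqP: cS; rewrite cards_eq0 => /eqP->; rewrite set0U leq_addr.
have /card_gt0P[v vS] : 0 < #|S| by rewrite cS.
rewrite (big_setD1 v vS) /= (@k_in_setD1 v); last by rewrite inE vS.
have cSv : #|S :\ v| = m by have := cardsD1 v S; rewrite vS cS => -[].
have := IH _ cSv.
have sub : (v |: (S :\ v) :|: W) :\ v \subset S :\ v :|: W.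
  by apply/subsetP => x; rewrite !inE => /andP[/negPf->].
have := k_inS t.+1 sub; have := k_inS t (subsetIr (S :|: W) (nbhd v)).
by rewrite setD1K //; lia.
Qed.

(** The degree sum over S counts edges inside S twice and edges from S to W once;
    adding the degrees into W makes every edge meeting S count twice. The term
    on W is what an upper bound on the full degrees alone would lose. *)
Lemma edges_delete_set S W : [disjoint S & W] ->
  2 * k_in (S :|: W) 2 =
  2 * k_in W 2 + \sum_(v in S) (#|(S :|: W) :&: nbhd v| + #|W :&: nbhd v|).
Proof.
elim: {S}#|S| {-2}S (erefl #|S|) => [|m IH] S cS dSW.
  by move/eqP: cS; rewrite cards_eq0 => /eqP->; rewrite set0U big_set0 addn0.
have /card_gt0P[v vS] : 0 < #|S| by rewrite cS.
have cSv : #|S :\ v| = m by have := cardsD1 v S; rewrite vS cS => -[].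
have vW : v \notin W by rewrite (disjointFr dSW).
have dS'W : [disjoint S :\ v & W] by apply: disjointWl dSW; rewrite subsetDl.
have eS : S :|: W = v |: (S :\ v :|: W) by rewrite setUA setD1K.
have vS' : v \notin S :\ v :|: W by rewrite !inE eqxx.
rewrite (big_setD1 v vS) /= {1}eS k_in_setU1 // mulnDr IH // k_in1.
have -> : (S :|: W) :&: nbhd v = (S :\ v :|: W) :&: nbhd v.
  by apply/setP => x; rewrite eS !inE; case: eqP => // ->; rewrite sg_irr !andbF.
have -> : \sum_(i in S :\ v) (#|(S :|: W) :&: nbhd i| + #|W :&: nbhd i|)
  = \sum_(i in S :\ v) (#|(S :\ v :|: W) :&: nbhd i| + #|W :&: nbhd i|)
    + #|(S :\ v) :&: nbhd v|.
  rewrite -sum1_card.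
  rewrite [X in _ + X](eq_bigl (fun i => (i \in S :\ v) && G v i)); last first.
    by move=> i; rewrite !inE.
  rewrite [X in _ + X]big_mkcondr -big_split /=; apply: eq_bigr => i iS.
  suff -> : #|(S :|: W) :&: nbhd i| = #|(S :\ v :|: W) :&: nbhd i| + G v i.
    by case: (G v i); lia.
  rewrite (cardsD1 v) addnC; congr (_ + _); last by rewrite eS !inE eqxx sg_sym.
  apply: eq_card => x; rewrite eS !inE; case: eqP => // ->; rewrite (negPf vW).
  by [].
have -> : #|(S :\ v :|: W) :&: nbhd v| = #|(S :\ v) :&: nbhd v| + #|W :&: nbhd v|.
  rewrite setIUl cardsU [X in _ - X](_ : _ = 0) ?subn0 //.
  apply/eqP; rewrite cards_eq0 setI_eq0.
  by apply: disjointWl (subsetIl _ _) (disjointWr (subsetIl _ _) dS'W).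
lia.
Qed.

End CliqueCount.

Lemma k_in_imset (V W : finType) (G : sgraph V) (H : sgraph W) (f : V -> W)
    (A : {set V}) t :
  injective f -> (forall x y, H (f x) (f y) = G x y) ->
  k_in H (f @: A) t = k_in G A t.
Proof.
move=> injf fH; rewrite /k_in -(card_imset _ (imset_inj injf)).
apply: eq_card => X; rewrite !inE; apply/idP/imsetP => [/and3P[XA clX cX] | [Y + ->]].
  have eX : X = f @: (f @^-1: X).
    apply/setP => y; apply/idP/imsetP => [yX | [x + ->]]; last by rewrite inE.
    have /imsetP[x xA e] := subsetP XA y yX.
    by exists x => //; rewrite inE -e.
  exists (f @^-1: X) => //; rewrite inE -(card_imset _ injf) -eX cX andbT.
  apply/andP; split.
    apply/subsetP => x; rewrite inE => /(subsetP XA)/imsetP[z zA /injf->] //.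
  apply/is_cliqueP => x y; rewrite !inE => xX yX nxy; rewrite -fH.
  by move/is_cliqueP: clX; apply=> //; rewrite (inj_eq injf).
rewrite inE => /and3P[YA clY cY]; rewrite imsetS // card_imset // cY andbT /=.
apply/is_cliqueP => _ _ /imsetP[x xY ->] /imsetP[y yY ->]; rewrite (inj_eq injf) fH.
by move/is_cliqueP: clY; apply.
Qed.

Lemma k_in_eq_in (V : finType) (G H : sgraph V) (A : {set V}) t :
  {in A &, G =2 H} -> k_in G A t = k_in H A t.
Proof.
move=> GH; apply: eq_card => X; rewrite !inE; case XA: (X \subset A) => //=.
congr (_ && _); apply/is_cliqueP/is_cliqueP => cl x y xX yX nxy.
  by rewrite -GH ?cl // (subsetP XA).
by rewrite GH ?cl // (subsetP XA).
Qed.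

(** * Zykov's theorem *)

Definition k_turan r n t := num_cliques (turan r n) t.
Definition below n m : {set 'I_n} := [set i : 'I_n | i < m].

Lemma k_in_below r n m t : m <= n -> k_in (turan r n) (below n m) t = k_turan r m t.
Proof.
move=> mn; rewrite /k_turan -k_in_setT.
have injw : injective (widen_ord mn) by move=> i j /(congr1 val) /= e; apply: val_inj.
rewrite -(@k_in_imset _ _ (turan r m) (turan r n) (widen_ord mn) setT t injw) //.
congr (k_in _ _ _); apply/setP => i; rewrite inE;
  apply/idP/imsetP => [im | [j _ ->]] /=.
  by exists (Ordinal im); [rewrite inE | apply: val_inj].
by [].
Qed.

Lemma leq_k_turan r m n t : m <= n -> k_turan r m t <= k_turan r n t.
Proof.
move=> mn; rewrite -(k_in_below r t mn) -(k_in_below r t (leqnn n)).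
by apply: k_inS; apply/subsetP => i; rewrite !inE => /leq_trans; apply.
Qed.

Lemma modn_inj_window r m i j :
  m <= i < m + r -> m <= j < m + r -> i %% r = j %% r -> i = j.
Proof.
move=> hi hj e; wlog ij : i j hi hj e / i <= j.
  by move=> W; case/orP: (leq_total i j) => ?; [|symmetry]; apply: W.
have : j - i = 0 %[mod r].
  by apply/eqP; rewrite -(eqn_modDr i) subnK // add0n e.
rewrite mod0n modn_small; lia.
Qed.

Lemma card_below n m : m <= n -> #|below n m| = m.
Proof. by move=> mn; rewrite cardsE -[LHS]sum1_card (big_ord_narrow mn) sum1_card
  card_ord. Qed.

(** The last q <= r vertices lie in distinct classes, so they form a clique, and
    an earlier vertex misses at most one of them. *)
Lemma k_turan_recursion r m q t : q <= r ->
  \sum_(s < t.+1) k_turan r m s * 'C(q - s, t - s) <= k_turan r (m + q) t.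
Proof.
move=> qr; set n := m + q; have mn : m <= n by apply: leq_addr.
pose K := ~: below n m.
have cK : #|K| = q.
  by rewrite cardsCs setCK card_ord card_below // /n addKn.
have dK : [disjoint K & below n m] by rewrite -setI_eq0 setIC setICr.
have Kwin (k : 'I_n) : k \in K -> m <= k < m + r.
  rewrite !inE -leqNgt => -> /=; apply: leq_trans (ltn_ord k) _.
  by rewrite leq_add2l.
have KP : is_clique (turan r n) K.
  apply/is_cliqueP => x y xK yK; apply: contra => /eqP e.
  by apply/eqP/val_inj/(modn_inj_window (Kwin _ xK) (Kwin _ yK)).
have := @k_in_near_complete_union _ (turan r n) K (below n m) t KP dK _.
rewrite cK setUC setUCr k_in_setT.
have -> : \sum_(s < t.+1) k_in (turan r n) (below n m) s * 'C(q - s, t - s)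
   = \sum_(s < t.+1) k_turan r m s * 'C(q - s, t - s).
  by apply: eq_bigr => s _; rewrite k_in_below.
apply=> c _ k k' kK k'K; rewrite !negbK => /eqP e /eqP e'.
by apply/val_inj/(modn_inj_window (Kwin _ kK) (Kwin _ k'K)); rewrite e.
Qed.

(** The common starting point of the two upper bounds below, which differ only in
    what they compare the recursion with. *)
Lemma max_clique_recursion (V : finType) (G : sgraph V) (A : {set V}) :
  A != set0 ->
  exists K : {set V}, let q := #|K| in
  [/\ K \subset A, is_clique G K, 0 < q, #|A| = #|A :\: K| + q
    & (forall C : {set V}, C \subset A -> is_clique G C -> #|C| <= q) /\
      forall t, k_in G A t <= \sum_(s < t.+1) k_in G (A :\: K) s * 'C(q - s, t - s)].
Proof.
case/set0Pn => x xA; have [K /andP[KA clK] maxK] := exists_max_clique G A.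
have eA : A = K :|: A :\: K by rewrite -{1}(setID A K) (setIidPr KA).
have dKA : [disjoint K & A :\: K].
  by rewrite -setI_eq0 setIDA setIC setDIl setDv setI0.
exists K; split=> //.
- rewrite -(cards1 x); apply: maxK; first by rewrite sub1set.
  by apply/is_cliqueP => u v /set1P-> /set1P->; rewrite eqxx.
- by rewrite -(cardsID K A) (setIidPr KA) addnC.
split=> // t; rewrite {1}eA; apply: k_in_max_clique_union => // C.
by rewrite -eA; apply: maxK.
Qed.

(** Induction on |A|: a maximum clique of A makes the recursion an upper bound,
    while in the Turan graph the same recursion is a lower bound. *)
Theorem zykov (V : finType) (G : sgraph V) r (A : {set V}) t :
  (forall C : {set V}, C \subset A -> is_clique G C -> #|C| <= r) ->
  k_in G A t <= k_turan r #|A| t.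
Proof.
elim: {A}#|A| {-2}A (leqnn #|A|) t => [|a IH] A cA t Afree;
  have [->|A0] := eqVneq A set0; try by rewrite k_in_set0 cards0 /k_turan -k_in_setT;
  case: t => [|t] //; rewrite k_in0.
  by move: cA; rewrite leqn0 cards_eq0 (negPf A0).
have [K [KA clK K0 cAK [_ rec]]] := max_clique_recursion G A0.
rewrite cAK; apply: leq_trans (rec t) _.
apply: leq_trans (k_turan_recursion _ _ (Afree _ KA clK)).
apply: leq_sum => s _; rewrite leq_mul2r IH ?orbT //; first by lia.
by move=> C CA; apply: Afree; apply: subset_trans CA (subsetDl _ _).
Qed.

(** * Clique densities and growth of Turan graphs *)

Lemma bin_mul_sub q t s : s <= t -> 'C(q, s) * 'C(q - s, t - s) = 'C(q, t) * 'C(t, s).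
Proof.
move=> st; have [qt|tq] := ltnP q t.
  have [qs|sq] := ltnP q s; first by rewrite (bin_small qt) (bin_small qs).
  by rewrite (bin_small qt) ['C(q - s, _)]bin_small ?muln0 //; lia.
have sq := leq_trans st tq.
apply/eqP; rewrite -(eqn_pmul2r (fact_gt0 s)) -(eqn_pmul2r (fact_gt0 (t - s))).
rewrite -(eqn_pmul2r (fact_gt0 (q - t))); apply/eqP.
have := bin_fact tq; have := bin_fact sq; have := bin_fact st.
have : t - s <= q - s by lia.
move/bin_fact; rewrite (_ : q - s - (t - s) = q - t); last by lia.
move=> h1 h2 h3 h4; transitivity q`!.
  by rewrite -h3 -h1; ring.
by rewrite -h4 -h2; ring.
Qed.

(** In other words, C(q,t)/q^t is nondecreasing in q. *)
Lemma leq_bin_expn q r t : q <= r -> 'C(q, t) * r ^ t <= 'C(r, t) * q ^ t.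
Proof.
move=> qr; elim: t => [|t IH]; first by rewrite !bin0 !expn0.
rewrite -(@leq_pmul2l t.+1) // !mulnA !mul_bin_left !expnS.
have : (q - t) * r <= (r - t) * q.
  by rewrite !mulnBl (mulnC r q) leq_sub2l // leq_mul2l qr orbT.
by move=> h; have := leq_mul h IH; lia.
Qed.

(** The expression C(q,t) (a/q)^t satisfies the maximum clique recursion exactly,
    by the binomial theorem. It is first proved with the size q of a maximum
    clique and then weakened to r, so that the induction can use the q of the
    whole set on the remainder. *)
Lemma k_in_density (V : finType) (G : sgraph V) r (A : {set V}) t :
  (forall C : {set V}, C \subset A -> is_clique G C -> #|C| <= r) ->
  k_in G A t * r ^ t <= 'C(r, t) * #|A| ^ t.
Proof.
elim: {A}#|A| {-2}A (leqnn #|A|) r t => [|a IH] A cA r t Afree;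
  have [->|A0] := eqVneq A set0;
  try by rewrite k_in_set0 cards0; case: t => [|t]; rewrite ?bin0.
  by move: cA; rewrite leqn0 cards_eq0 (negPf A0).
have [K [KA clK K0 cAK [maxK rec]]] := max_clique_recursion G A0.
have qr := Afree _ KA clK.
set q := #|K| in K0 cAK maxK rec qr; set b := #|A :\: K| in cAK.
have key : k_in G A t * q ^ t <= 'C(q, t) * #|A| ^ t.
  apply: leq_trans (leq_mul (rec t) (leqnn _)) _.
  rewrite cAK addnC expnDn big_distrr big_distrl /=; apply: leq_sum => s _.
  have st : s <= t by rewrite -ltnS.
  have IHs : k_in G (A :\: K) s * q ^ s <= 'C(q, s) * b ^ s.
    apply: IH => [|C CA]; first by lia.
    by apply: maxK; apply: subset_trans CA (subsetDl _ _).
  have -> : q ^ t = q ^ s * q ^ (t - s) by rewrite -expnD subnKC.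
  have := bin_mul_sub q st; set c := 'C(q - s, _) => e.
  rewrite [X in _ <= X]mulnA -e.
  apply: etrans (leq_mul IHs (leqnn (c * q ^ (t - s)))).
  congr (_ <= _); ring.
have h := leq_bin_expn t qr.
have q0 : 0 < q ^ t by rewrite expn_gt0 K0.
rewrite -(leq_pmul2r q0); have := leq_mul key (leqnn (r ^ t)).
have := leq_mul h (leqnn (#|A| ^ t)); lia.
Qed.

Lemma turan_clique_card r n (C : {set 'I_n}) : 0 < r ->
  is_clique (turan r n) C -> #|C| <= r.
Proof.
move=> r0 /is_cliqueP clC; pose f (i : 'I_n) := Ordinal (ltn_pmod i r0).
have injf : {in C &, injective f}.
  move=> x y xC yC /(congr1 val) /= e; apply: contraTeq isT => nxy.
  by have := clC _ _ xC yC nxy; rewrite /= /turan_rel e eqxx.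
by rewrite -(card_in_imset injf) -[r in _ <= r]card_ord max_card.
Qed.

Lemma k_turan_density r n t : 0 < r -> k_turan r n t * r ^ t <= 'C(r, t) * n ^ t.
Proof.
move=> r0; have := @k_in_density _ (turan r n) r setT t.
rewrite k_in_setT cardsT card_ord; apply=> C _; exact: turan_clique_card.
Qed.

Definition earlier_nbrs r n m : {set 'I_n} :=
  [set i : 'I_n | (i < m) && (i %% r != m %% r)].

Lemma k_turan_succ r m t :
  k_turan r m.+1 t.+1
  = k_turan r m t.+1 + k_in (turan r m.+1) (earlier_nbrs r m.+1 m) t.
Proof.
rewrite -(k_in_below r _ (leqnn m.+1)) -(k_in_below r t.+1 (leqnSn m)).
have mx : ord_max \in below m.+1 m.+1 by rewrite inE /=.
rewrite (k_in_setD1 _ _ mx).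
congr (_ + _); congr (k_in _ _ _); apply/setP => i; rewrite !inE.
  by rewrite -val_eqE /= ltnS -ltn_neqAle.
rewrite /= /turan_rel /= eq_sym ltnS [i < m]ltn_neqAle.
by case: (i =P m :> nat) => [->|_] //=; rewrite eqxx andbF.
Qed.

(** The neighbourhood is complete (r-1)-partite with every class of size at least
    a. Adding r consecutive vertices adds one vertex to each of its classes, and
    C(r-1,t) a^t satisfies the resulting recursion exactly. *)
Lemma earlier_nbrs_cliques_ge r n a b t : 0 < r -> a * r + b <= n ->
  'C(r.-1, t) * a ^ t <= k_in (turan r n) (earlier_nbrs r n (a * r + b)) t.
Proof.
move=> r0; elim: a t => [|a IH] t le_n.
  by case: t => [|t]; rewrite ?k_in0 ?bin0 // exp0n // muln0.
set m := a * r + b; have em : a.+1 * r + b = m + r by rewrite /m mulSn; lia.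
rewrite em in le_n *.
pose K : {set 'I_n} := [set i : 'I_n | m < i < m + r].
have lt_mn : m < n by lia.
have cK : #|K| = r.-1.
  have -> : K = below n (m + r) :\: below n m.+1.
    by apply/setP => i; rewrite !inE -leqNgt.
  rewrite cardsDS; last by apply/subsetP => i; rewrite !inE; lia.
  by rewrite !card_below //; lia.
have mod_mr : (m + r) %% r = m %% r by rewrite modnDr.
have -> : earlier_nbrs r n (m + r) = K :|: earlier_nbrs r n m.
  apply/setP => i; rewrite !inE mod_mr.
  case: (ltngtP i m) => [im|mi|->] /=; rewrite ?eqxx ?andbF ?orbF ?andbT //.
    by rewrite (leq_trans im) ?leq_addr.
  case: ltnP => //= imr; apply/negP => /eqP e.
  have := @modn_inj_window r m i m; rewrite e => /(_ _ _ erefl); lia.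
have Kwin (k : 'I_n) : k \in K -> m <= k < m + r by rewrite inE; lia.
have clK : is_clique (turan r n) K.
  apply/is_cliqueP => x y xK yK; apply: contra => /eqP e.
  by apply/eqP/val_inj/(modn_inj_window (Kwin _ xK) (Kwin _ yK)).
have dK : [disjoint K & earlier_nbrs r n m].
  by apply/pred0P => i; rewrite /= !inE; lia.
have := @k_in_near_complete_union _ (turan r n) K (earlier_nbrs r n m) t clK dK _.
rewrite cK => le; apply: leq_trans (le _); last first.
  move=> c _ k k' kK k'K; rewrite !negbK => /eqP e /eqP e'.
  by apply/val_inj/(modn_inj_window (Kwin _ kK) (Kwin _ k'K)); rewrite e.
rewrite -[a.+1]addn1 addnC expnDn big_distrr /=; apply: leq_sum => s _.
have st : s <= t by rewrite -ltnS.
rewrite exp1n mul1n mulnA -bin_mul_sub // mulnAC leq_mul2r IH ?orbT //.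
by rewrite -/m; lia.
Qed.

Lemma k_turan_succ_ge r m t : 0 < r ->
  k_turan r m t.+1 + 'C(r.-1, t) * (m %/ r) ^ t <= k_turan r m.+1 t.+1.
Proof.
move=> r0; rewrite k_turan_succ leq_add2l.
have := @earlier_nbrs_cliques_ge r m.+1 (m %/ r) (m %% r) t r0.
by rewrite -divn_eq; apply.
Qed.

Lemma k_turan_add_ge r m j t : 0 < r ->
  k_turan r m t.+1 + 'C(r.-1, t) * \sum_(k < j) ((m + k) %/ r) ^ t
    <= k_turan r (m + j) t.+1.
Proof.
move=> r0; elim: j => [|j IH]; first by rewrite big_ord0 muln0 !addn0.
rewrite big_ord_recr /= mulnDr addnA addnS.
by apply: leq_trans (k_turan_succ_ge _ _ r0); rewrite leq_add2r.
Qed.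

(** * Numerical estimates *)

(** The power mean inequality for two terms and the exponent p + 1. *)
Lemma leq_expn_add p x y : (x + y) ^ p.+1 <= 2 ^ p * (x ^ p.+1 + y ^ p.+1).
Proof.
elim: p => [|p IH]; first by rewrite mul1n !expn1.
have cheb : (x + y) * (x ^ p.+1 + y ^ p.+1) <= 2 * (x ^ p.+2 + y ^ p.+2).
  rewrite (expnS x p.+1) (expnS y p.+1).
  wlog xy : x y {IH} / x <= y.
    move=> W; case/orP: (leq_total x y) => /W // h.
    by rewrite addnC [X in _ * X]addnC [X in _ <= _ * X]addnC.
  have: x ^ p.+1 <= y ^ p.+1 by rewrite leq_exp2r.
  set X := x ^ _; set Y := y ^ _ => XY.
  have := leq_mul (leq_subr 0 (y - x)) (leq_subr 0 (Y - X)).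
  by nia.
rewrite (expnS (x + y)) (expnS 2).
have h1 := leq_mul (leqnn (x + y)) IH; have h2 := leq_mul (leqnn (2 ^ p)) cheb.
apply: leq_trans h1 _; rewrite mulnCA; apply: leq_trans h2 _.
by rewrite mulnA (mulnC _ 2).
Qed.

(** Jensen's inequality along an arithmetic progression: pair each term with its
    mirror image, the mean of the two being b + (m-1)/2. *)
Lemma jensen_progression p b m :
  m * (2 * b + m.-1) ^ p <= 2 ^ p * \sum_(k < m) (b + k) ^ p.
Proof.
case: p => [|p]; first by rewrite !expn0 muln1 mul1n sum1_card card_ord.
have rev : \sum_(k < m) (b + k) ^ p.+1 = \sum_(k < m) (b + (m - k.+1)) ^ p.+1.
  by rewrite (reindex_inj rev_ord_inj).
have tw : 2 * (\sum_(k < m) (b + k) ^ p.+1)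
    = \sum_(k < m) ((b + k) ^ p.+1 + (b + (m - k.+1)) ^ p.+1).
  by rewrite big_split /= -rev mul2n addnn.
rewrite (expnS 2) [2 * 2 ^ _]mulnC -mulnA tw big_distrr /=.
have -> : m * (2 * b + m.-1) ^ p.+1 = \sum_(k < m) (2 * b + m.-1) ^ p.+1.
  by rewrite sum_nat_const card_ord.
apply: leq_sum => k _; apply: leq_trans (leq_expn_add _ _ _).
by rewrite leq_exp2r //; have := ltn_ord k; lia.
Qed.

Lemma sum_floor_pow_ge r w m p : 0 < r -> r <= w ->
  \sum_(k < m) (w.+1 - r + k) ^ p <= r ^ p * \sum_(k < m) ((w + k) %/ r) ^ p.
Proof.
move=> r0 rw; rewrite big_distrr /=; apply: leq_sum => k _.
rewrite -expnMn; case: p => // p; rewrite leq_exp2r //.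
have := divn_eq (w + k) r; have := ltn_pmod (w + k) r0; lia.
Qed.

(** Here m = j - 1, w = n - j, and p = t - 1. The left-hand side bounds the
    cliques lost with S, the right-hand side is the gain from T_r(w) to
    T_r(w + m), up to the common factor C(r-1,p). The gain is
    at least m times a p-th power by Jensen's inequality, and the loss is at most
    m times a p-th power by a Bernoulli estimate; the linear hypothesis compares
    the two bases. *)
Lemma cliques_lost_lt_gained r L m w p :
  3 <= r -> 0 < m -> 0 < p -> r <= w ->
  2 * r * (m + 2 * L + 1) < r.-1 * (2 * (w.+1 - r) + m.-1) ->
  m.+1 * (m + L) ^ p < r.-1 ^ p * \sum_(k < m) ((w + k) %/ r) ^ p.
Proof.
move=> r3 m0 p0 rw base.
have r0 : 0 < (2 * r) ^ p by rewrite expn_gt0; lia.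
have mp0 : 0 < m ^ p by rewrite expn_gt0 m0.
set b := w.+1 - r in base *.
(* (m+1) m^(p-1) <= (m+1)^p turns the extra term of the left-hand side into a
   factor 1 + 1/m inside the power. *)
have bern : m.+1 * (m + L) ^ p <= m * (m + 2 * L + 1) ^ p.
  rewrite -(leq_pmul2r mp0).
  have h1 : m.+1 * m ^ p <= m * m.+1 ^ p.
    case: p p0 {r0 mp0} => // p _; rewrite !expnS mulnCA !leq_mul2l.
    by case: p => [|p]; rewrite ?orbT // leq_exp2r // leqnSn !orbT.
  have h2 : (m.+1 * (m + L)) ^ p <= (m * (m + 2 * L + 1)) ^ p.
    by rewrite leq_exp2r //; nia.
  rewrite !expnMn in h2.
  rewrite mulnAC; apply: leq_trans (leq_mul h1 (leqnn _)) _; rewrite -mulnA.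
  by apply: leq_trans (leq_mul (leqnn m) h2) _; rewrite (mulnC (m ^ p)) mulnA.
have mid : m * (2 * r * (m + 2 * L + 1)) ^ p < m * (r.-1 * (2 * b + m.-1)) ^ p.
  by rewrite ltn_pmul2l // ltn_exp2r.
rewrite -(ltn_pmul2l r0); apply: leq_ltn_trans (leq_mul (leqnn _) bern) _.
rewrite mulnCA -expnMn; apply: leq_trans mid _.
rewrite expnMn mulnCA [X in _ <= X]mulnCA leq_mul2l; apply/orP; right.
apply: leq_trans (jensen_progression p b m) _.
by rewrite expnMn -mulnA leq_mul2l sum_floor_pow_ge ?orbT //; lia.
Qed.

Lemma sum_squares_progression b m :
  6 * \sum_(k < m) (b + k) ^ 2
  = 6 * m * b ^ 2 + 6 * b * (m * m.-1) + m * m.-1 * (2 * m).-1.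
Proof.
elim: m => [|m IH]; first by rewrite big_ord0 !muln0 !mul0n.
rewrite big_ord_recr [nat_of_ord _]/= mulnDr IH; case: m {IH} => [|m];
  first by rewrite !muln0 /=; ring.
rewrite (_ : (2 * m.+1).-1 = 2 * m + 1); last by lia.
rewrite (_ : (2 * m.+2).-1 = 2 * m + 3); last by lia.
by rewrite !succnK; ring.
Qed.

(** For r = 3 and w close to m the bound by Jensen's inequality on the gain has
    the same leading term m^3 as the loss. The exact sum of squares is about
    (7/3) m^3, and 4/9 of it beats m^3 because 28/27 > 1. *)
Lemma triangles_lost_lt_gained L m w :
  200 * L.+1 <= m -> m + L < w ->
  m.+1 * (m + L) ^ 2 < 2 ^ 2 * \sum_(k < m) ((w + k) %/ 3) ^ 2.
Proof.
move=> mL mw.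
have := @sum_floor_pow_ge 3 w m 2 isT; set F := \sum_(k < m) ((w + k) %/ 3) ^ 2 => hF.
have {}hF : \sum_(k < m) (m.-1 + k) ^ 2 <= 9 * F.
  apply: leq_trans (hF _); last by lia.
  by apply: leq_sum => k _; rewrite leq_exp2r //; lia.
have := sum_squares_progression m.-1 m; move: hF; set Q := \sum_(k < m) _ => hF eQ.
suff : 54 * (m.+1 * (m + L) ^ 2) < 4 * (6 * Q) by lia.
rewrite eQ; case: m mL {mw F Q hF eQ} => // m mL.
rewrite (_ : (2 * m.+1).-1 = 2 * m + 1) /=; last by lia.
have h1 : 199 <= m by lia.
have h2 : 200 * L <= m by lia.
(* Each further monomial of the expanded claim is small against one of higher
   degree in m. *)
have m3 : m ^ 3 = m * m ^ 2 by [].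
have a1 : 200 * (L * m ^ 2) <= m ^ 3 by rewrite m3 mulnA leq_mul2r h2 orbT.
have a2 : 199 * m ^ 2 <= m ^ 3 by rewrite m3 leq_mul2r h1 orbT.
have a3 : 200 * (L * m) <= m ^ 2 by nia.
have a0 : 40000 * L ^ 2 <= m ^ 2.
  by rewrite (_ : 40000 * L ^ 2 = (200 * L) ^ 2) ?leq_exp2r // expnMn.
have a4 : 40000 * L ^ 2 * m <= m ^ 3.
  by rewrite m3 (mulnC m) leq_mul2r a0 orbT.
have a5 : 199 * m <= m ^ 2 by nia.
have a6 : L ^ 2 * 200 <= L * m by nia.
rewrite (_ : m.+2 * (m.+1 + L) ^ 2 = (m + 2) * (m + 1 + L) ^ 2);
  last by congr (_ * _ ^ _); lia.
nia.
Qed.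

(** If W, of size w close to n/2, is almost triangle-free, then the total is about
    w^2/4 + m^2, against w^2/3 + m^2 for the Turan graph. Here q bounds the edges
    of a triangle-free part of W, and eT is the number of edges of T_3(w). *)
Lemma edges_sparse_side_lt L m w q e eT :
  m <= w -> 200 * L.+2 <= w -> 3 * eT >= w ^ 2 - 5 * w ->
  4 * q <= w ^ 2 -> e <= q + (4 * L + 7) * (2 * w) + m.+1 * (m + L) ->
  e < eT + m * m.-1.
Proof.
move=> mw wL hT hq he.
have a1 : 200 * L.+2 * w <= w ^ 2 by rewrite (_ : w ^ 2 = w * w) // leq_mul2r wL orbT.
have a2 : L * m <= L * w by rewrite leq_mul2l mw orbT.
have a3 : m * m.-1 + m = m ^ 2 by case: m {mw he a2} => // m /=; ring.
rewrite (_ : m.+1 * (m + L) = m ^ 2 + m + L * m + L) in he; last by ring.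
have: 200 * L * w + 400 * w <= w ^ 2 by lia.
nia.
Qed.

(** * Many vertices of low degree *)

Lemma clique_free_card (V : finType) (G : sgraph V) r (C : {set V}) :
  clique_free G r.+1 -> is_clique G C -> #|C| <= r.
Proof.
move=> Gfree clC; rewrite leqNgt; apply/negP => rC.
have : 0 < #|[set B : {set V} | B \subset C & #|B| == r.+1]|.
  by rewrite cards_draws bin_gt0.
case/card_gt0P => B; rewrite inE => /andP[BC /eqP cB].
exact: Gfree (is_cliqueS BC clC) cB.
Qed.

Lemma clique_in_nbhd (V : finType) (G : sgraph V) r v (C : {set V}) :
  clique_free G r.+1 -> C \subset nbhd G v -> is_clique G C -> #|C| <= r.-1.
Proof.
move=> Gfree /subsetP CN clC.
have vC : v \notin C by apply/negP => /CN; rewrite inE sg_irr.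
have : #|v |: C| <= r.
  apply: clique_free_card Gfree _; apply/is_cliqueP => x y.
  rewrite !inE => /orP[/eqP->|xC] /orP[/eqP->|yC].
  - by rewrite eqxx.
  - by have := CN y yC; rewrite inE.
  - by have := CN x xC; rewrite inE sg_sym.
  - by move/is_cliqueP: clC; apply.
by rewrite cardsU1 vC; lia.
Qed.

(** Zykov's theorem applied to the complement of S and to the neighbourhood of
    each vertex of S, where the clique number drops by one. *)
Lemma k_in_low_degree (V : finType) (G : sgraph V) r (S : {set V}) s t :
  clique_free G r.+1 -> {in S, forall v, deg G v <= s} ->
  num_cliques G t.+1 <= k_turan r #|~: S| t.+1 + #|S| * k_turan r.-1 s t.
Proof.
move=> Gfree degS; rewrite -k_in_setT -(setUCr S).
apply: leq_trans (k_in_delete_set _ _ _ _) _; apply: leq_add.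
  by apply: zykov => C _; apply: clique_free_card.
rewrite -sum_nat_const; apply: leq_sum => v vS.
apply: leq_trans (leq_k_turan _ _ (degS _ vS)).
by apply: zykov => C; apply: clique_in_nbhd.
Qed.

(** The binomial factor C(r-1,p) common to loss and gain vanishes for p >= r, which
    is why strictness is only claimed for p < r. *)
Lemma k_turan_gain r s m w p : 1 < r ->
  m.+1 * s ^ p < r.-1 ^ p * \sum_(k < m) ((w + k) %/ r) ^ p ->
  k_turan r w p.+1 + m.+1 * k_turan r.-1 s p <= k_turan r (w + m) p.+1
  /\ (p < r -> k_turan r w p.+1 + m.+1 * k_turan r.-1 s p < k_turan r (w + m) p.+1).
Proof.
move=> r1; set F := \sum_(k < m) _ => base.
have r0 : 0 < r.-1 ^ p by rewrite expn_gt0; lia.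
have dens := @k_turan_density r.-1 s p; have gain := @k_turan_add_ge r w m p.
have {}dens : m.+1 * k_turan r.-1 s p * r.-1 ^ p <= 'C(r.-1, p) * (m.+1 * s ^ p).
  by rewrite mulnCA -mulnA leq_mul2l dens ?orbT //; lia.
split.
  apply: leq_trans (gain _); last by lia.
  rewrite leq_add2l -(leq_pmul2r r0) (leq_trans dens) // -mulnA leq_mul2l.
  by rewrite (mulnC F) ltnW ?orbT.
move=> pr; apply: leq_trans (gain _); last by lia.
rewrite ltn_add2l -(ltn_pmul2r r0) (leq_ltn_trans dens) // -mulnA ltn_mul2l.
by rewrite (mulnC F) bin_gt0 base andbT; lia.
Qed.

(** Sum the gains of the successive vertices, starting from the empty graph. *)
Lemma k_turan3_edges_ge w : w ^ 2 - 5 * w <= 3 * k_turan 3 w 2.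
Proof.
have := @k_turan_add_ge 3 0 w 1 isT; rewrite add0n (_ : 'C(3.-1, 1) = 2) // => h.
apply: leq_trans (leq_mul (leqnn 3) (leq_trans (leq_addl _ _) h)).
have : 2 * \sum_(k < w) k <= 2 * \sum_(k < w) (3 * ((0 + k) %/ 3) ^ 1 + 2).
  rewrite leq_mul2l /=; apply: leq_sum => k _; rewrite add0n expn1.
  have := divn_eq k 3; have := ltn_pmod k (isT : 0 < 3); lia.
rewrite big_split /= -big_distrr sum_nat_const card_ord /=.
have -> : \sum_(k < w) k = 'C(w, 2) by rewrite -bin2_sum big_mkord.
rewrite -mul_bin_diag bin1 => h1.
by case: w {h} h1 => // w /=; rewrite (_ : w.+1 ^ 2 = w.+1 * w + w.+1); [lia | ring].
Qed.

(** The case r = 3 with S almost half of the vertices. Counting each vertex of S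
    with its full degree would allow as many edges as the Turan graph to leading
    order; the dichotomy is whether some vertex of S sees almost all of W. *)
Lemma edges_half_low_degree (V : finType) (G : sgraph V) L m w (S : {set V}) :
  clique_free G 4 -> #|S| = m.+1 -> #|~: S| = w -> m + L < w ->
  w <= m + 3 * L + 4 -> 200 * L.+2 <= m ->
  {in S, forall v, deg G v <= m + L} ->
  num_cliques G 2 < k_turan 3 (w + m) 2.
Proof.
move=> Gfree cS cW mLw wm mL degS.
have gain : k_turan 3 w 2 + m * m.-1 <= k_turan 3 (w + m) 2.
  have := @k_turan_add_ge 3 w m 1 isT; rewrite (_ : 'C(3.-1, 1) = 2) // => h.
  apply: leq_trans h; rewrite leq_add2l.
  have := @sum_floor_pow_ge 3 w m 1 isT; have := jensen_progression 1 (w.+1 - 3) m.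
  rewrite !expn1; set F := \sum_(k < m) ((w + k) %/ 3) ^ 1; set Q := \sum_(k < m) _.
  move=> h1 h2; have {}h2 : Q <= 3 * F by apply: h2; lia.
  have : m * (3 * m.-1) <= m * (2 * (w.+1 - 3) + m.-1) by rewrite leq_mul2l; lia.
  by lia.
(* The slack L + 4 makes the sum of the two degrees of each v in S at most
   2m - 4, and (m + 1)(2m - 4) < 2m(m - 1). *)
have [/forall_inP lowW | ] := boolP [forall v in S, #|~: S :&: nbhd G v| + L + 4 <= m].
  have dS : [disjoint S & ~: S] by rewrite -setI_eq0 setICr.
  have := edges_delete_set G dS; rewrite setUCr k_in_setT.
  have kW : k_in G (~: S) 2 <= k_turan 3 w 2.
    by rewrite -cW; apply: zykov => C _; apply: clique_free_card.
  have : \sum_(v in S) (#|setT :&: nbhd G v| + #|~: S :&: nbhd G v|)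
      <= m.+1 * (2 * m - 4).
    rewrite -cS -sum_nat_const; apply: leq_sum => v vS; rewrite setTI.
    have := degS v vS; rewrite /deg -/(nbhd G v); have := lowW v vS; lia.
  have : m.+1 * (2 * m - 4) + 2 <= 2 * (m * m.-1).
    case: m mL {cS mLw wm degS gain lowW} => [|[|k]] mL; [lia | lia |].
    rewrite (_ : 2 * k.+2 - 4 = 2 * k) ?succnK; last by lia.
    by lia.
  lia.
rewrite negb_forall => /existsP[v]; rewrite negb_imply => /andP[vS];
  rewrite -ltnNge => Dm.
set A := ~: S :&: nbhd G v in Dm.
have triA : 4 * k_in G A 2 <= w ^ 2.
  have := @k_in_density _ G 2 A 2; rewrite binn mul1n (mulnC _ (2 ^ 2)) => h.
  apply: leq_trans (h _) _.
    by move=> C CA clC; apply: (clique_in_nbhd Gfree (v := v)) => //;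
      apply: subset_trans CA (subsetIr _ _).
  by rewrite leq_exp2r // -cW subset_leq_card // subsetIl.
apply: leq_trans gain.
apply: (@edges_sparse_side_lt L m w (k_in G A 2)) => //; try lia.
  by apply: leq_trans (k_turan3_edges_ge w) _; rewrite mulnC.
have h1 : num_cliques G 2 <= k_in G (~: S) 2 + m.+1 * (m + L).
  rewrite -k_in_setT -(setUCr S); apply: leq_trans (k_in_delete_set _ _ _ _) _.
  rewrite leq_add2l -cS -sum_nat_const; apply: leq_sum => u uS.
  by rewrite k_in1; apply: degS.
have h2 : k_in G (~: S) 2 <= k_in G A 2 + (4 * L + 7) * (2 * w).
  have eW : ~: S = (~: S :\: A) :|: A.
    by rewrite -{1}(setID (~: S) A) setUC (setIidPr _) // subsetIl.
  rewrite {1}eW; apply: leq_trans (k_in_delete_set _ _ _ _) _; rewrite leq_add2l.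
  (* (m + 3L + 4) - (m - L - 3) *)
  have cWA : #|~: S :\: A| <= 4 * L + 7.
    by rewrite cardsDS ?subsetIl // cW; lia.
  apply: leq_trans (leq_mul cWA (leqnn _)); rewrite -sum_nat_const.
  apply: leq_sum => u _; rewrite k_in1; apply: leq_trans (max_card _) _.
  by rewrite -(cardsC S) cS cW; lia.
by apply: leq_trans h1 _; rewrite leq_add2r.
Qed.

(** The conclusion for j = m + 1 >= 2. The lower bound on w absorbs all the lower
    order terms and follows from n being large since w >= n/2. *)
Theorem low_degree_set_bound (V : finType) (G : sgraph V) r L m w (S : {set V}) :
  2 < r -> clique_free G r.+1 -> #|S| = m.+1 -> #|~: S| = w -> 0 < m ->
  m + L < w -> 4 * (r * L) + 2 * r + 2 * r ^ 2 + 1000 * L.+2 <= w ->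
  {in S, forall v, deg G v <= m + L} ->
  (forall p, 0 < p -> num_cliques G p.+1 <= k_turan r (w + m) p.+1)
  /\ num_cliques G 2 < k_turan r (w + m) 2.
Proof.
move=> r2 Gfree cS cW m0 mLw wbig degS.
have bound p := k_in_low_degree p Gfree degS.
have rw : r <= w by lia.
have [/andP[/eqP r3 near]|far] := boolP ((r == 3) && (w <= m + 3 * L + 4)); last first.
  have base : 2 * r * (m + 2 * L + 1) < r.-1 * (2 * (w.+1 - r) + m.-1).
    have e : 2 * (w.+1 - r) + m.-1 = 2 * w + m + 1 - 2 * r by lia.
    rewrite e; case: (eqVneq r 3) far => [->|r3 _]; first by rewrite andTb; lia.
    have r4 : 3 < r by lia.
    case: r r4 wbig {bound Gfree r2 r3 rw e} => // q q3 wbig /=.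
    have : q.+2 * m <= q.+2 * w by rewrite leq_mul2l; lia.
    have : 3 * w <= q * w by rewrite leq_mul2r -[3 <= q]ltnS q3 orbT.
    rewrite mulnBr ltn_subRL; lia.
  have key p : 0 < p -> _ := fun p0 =>
    k_turan_gain (ltnW r2) (cliques_lost_lt_gained r2 m0 p0 rw base).
  split=> [p p0|].
    by have [le _] := key p p0; apply: leq_trans (bound p) _; rewrite cS cW.
  have [_ lt] := key 1 isT; apply: leq_ltn_trans (bound 1) _; rewrite cS cW.
  by apply: lt; lia.
subst r; have lt2 := edges_half_low_degree Gfree cS cW mLw near _ degS.
have {}lt2 : num_cliques G 2 < k_turan 3 (w + m) 2 by apply: lt2; lia.
split=> // -[|[|[|p]]] // _; first exact: ltnW.
  have mL : 200 * L.+1 <= m by lia.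
  have [le _] := k_turan_gain (isT : 1 < 3) (triangles_lost_lt_gained mL mLw).
  by apply: leq_trans (bound 2) _; rewrite cS cW.
suff -> : num_cliques G p.+4 = 0 by [].
apply/eqP; rewrite cards_eq0; apply/eqP/setP => C; rewrite !inE.
by apply/andP => -[clC /eqP cC]; have := clique_free_card Gfree clC; rewrite cC.
Qed.

Lemma low_degree_set (V : finType) (G : sgraph V) j d :
  0 < j <= #|V| -> sorted_deg G j <= d ->
  exists2 S : {set V}, #|S| = j & {in S, forall v, deg G v <= d}.
Proof.
move=> /andP[j0 jV] le_d.
pose D := [set v | deg G v <= d].
have jD : j <= #|D|.
  pose s := degree_seq G.
  have ss : sorted leq s by apply: sort_sorted; exact: leq_total.
  have zs : size s = #|V| by rewrite size_sort size_map -cardE.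
  have -> : #|D| = count (fun x => x <= d) s.
    rewrite (permP (permEl (perm_sort _ _))) count_map enumT cardE /enum_mem
      size_filter.
    by apply: eq_count => v; rewrite /= inE.
  rewrite -(cat_take_drop j s) count_cat; apply: leq_trans (leq_addr _ _).
  have /eqP -> : count (fun x => x <= d) (take j s) == size (take j s).
    rewrite -all_count; apply/(all_nthP 0) => i; rewrite size_takel ?zs // => ij.
    rewrite nth_take //; apply: leq_trans le_d; rewrite /sorted_deg -/s.
    by apply: (sorted_leq_nth leq_trans leqnn) => //; rewrite ?inE ?zs; lia.
  by rewrite size_takel ?zs.
have : 0 < #|[set B : {set V} | B \subset D & #|B| == j]|.
  by rewrite cards_draws bin_gt0.
case/card_gt0P => B; rewrite inE => /andP[/subsetP BD /eqP cB].
by exists B => // v /BD; rewrite inE.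
Qed.

Lemma sorted_deg1_le (V : finType) (G : sgraph V) v : sorted_deg G 1 <= deg G v.
Proof.
pose s := degree_seq G.
have ss : sorted leq s by apply: sort_sorted; exact: leq_total.
have vs : deg G v \in s by rewrite mem_sort map_f ?mem_enum.
rewrite /sorted_deg -/s -(nth_index 0 vs).
have is_s : index (deg G v) s < size s by rewrite index_mem.
by apply: (sorted_leq_nth leq_trans leqnn) => //; rewrite inE; lia.
Qed.

(** * The colex Turan graph *)

Section ColexTuran.
Variables (r n L : nat).
Hypotheses (r1 : 1 < r) (Ln : 2 * L <= n).
Let H := turan r n.+1.
Let E := num_edges (turan r n).
Let C := colex_turan r n.+1 (E + L).
Let top : 'I_n.+1 := ord_max.

Definition top_nbrs_below (m : nat) : {set 'I_n.+1} :=
  [set k : 'I_n.+1 | (k < m) && (k %% r != n %% r)].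

Lemma below_clique_card : #|cliques_in H (below n.+1 n) 2| = E.
Proof. by rewrite -/(k_in H _ 2) k_in_below // /E num_edgesE. Qed.

Lemma top_notin_below (B : {set 'I_n.+1}) : (B \subset below n.+1 n) = (top \notin B).
Proof.
apply/subsetP/idP => [sB | topB x xB].
  by apply/negP => /sB; rewrite inE ltnn.
rewrite inE; have := ltn_ord x; rewrite ltnS leq_eqVlt => /orP[/eqP e|//].
by rewrite (_ : top = x) ?xB // in topB; apply: val_inj.
Qed.

(** Pairs avoiding the last vertex precede all pairs containing it, so fewer than
    E edges precede such a pair. *)
Lemma colex_below (i j : 'I_n.+1) : i < n -> j < n -> C i j = H i j.
Proof.
move=> iN jN; case Hij: (H i j); last first.
  by apply/negP => /andP[Hij' _]; rewrite -/(H i j) Hij in Hij'.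
apply/andP; split; first exact: Hij.
apply: ltn_addr; rewrite -below_clique_card; apply: proper_card.
have ij : [set i; j] \subset below n.+1 n by rewrite subUset !sub1set !inE iN.
apply/properP; split.
  apply/subsetP => B; rewrite inE edges_cliques inE => /andP[/andP[clB cB] lex].
  rewrite inE clB cB !andbT top_notin_below.
  apply: contraTN lex => topB; apply/negP => /exists_inP[x].
  rewrite inE => /andP[xB xij] /forall_inP/(_ top).
  rewrite !inE topB andbT /= -in_set2 -top_notin_below ij /= leqNgt => /(_ isT).
  by have := subsetP ij x xij; rewrite inE => ->.
exists [set i; j].
  have := edges_cliques H => /setP/(_ [set i; j]); rewrite !inE ij /= => <-.
  by apply/existsP; exists i; apply/existsP; exists j; rewrite eqxx andbT.
by rewrite inE; apply/negP => /andP[_ /exists_inP[x]]; rewrite setDv inE.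
Qed.

(** The edges before the pair {i, top} are those avoiding the top vertex together
    with the pairs {k, top} for k < i. *)
Lemma colex_top_count (i : 'I_n.+1) : H i top ->
  #|[set B in edges H | colex_lt B [set i; top]]| = E + #|top_nbrs_below i|.
Proof.
move=> Hit; have nit : i != top by apply: contraTneq Hit => ->; rewrite sg_irr.
have iN : i < n.
  have := ltn_ord i; rewrite ltnS leq_eqVlt => /orP[/eqP e|//].
  by case/eqP: nit; apply: val_inj.
pose f (k : 'I_n.+1) := [set k; top].
have ->: [set B in edges H | colex_lt B [set i; top]]
   = cliques_in H (below n.+1 n) 2 :|: f @: top_nbrs_below i.
  apply/setP => B; rewrite inE [RHS]inE.
  have eB : (B \in edges H) = is_clique H B && (#|B| == 2) by rewrite edges_cliques inE.
  rewrite [B \in cliques_in _ _ _]inE -eB top_notin_below.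
  case BE: (B \in edges H); last first.
    rewrite andbF /=; apply/esym/negbTE/negP => /imsetP[k].
    rewrite inE => /andP[ki kn] eBk; move: BE; rewrite eBk.
    rewrite inE => /existsP[]; exists k; apply/existsP; exists top.
    by rewrite eqxx andbT.
  case topB : (top \in B) => /=; last first.
    apply/exists_inP; exists top; first by rewrite !inE topB eqxx orbT.
    by apply/forall_inP => y _; have := ltn_ord y; rewrite ltnS.
  have [k kT eBk] : exists2 k, H k top & B = f k.
    move: BE topB; rewrite inE => /existsP[a /existsP[b /andP[ab /eqP->]]].
    rewrite !inE => /orP[] /eqP e; first by exists b;
      [rewrite e sg_sym | rewrite /f e setUC].
    by exists a; [rewrite e | rewrite /f e].
  have nkt : k != top by apply: contraTneq kT => ->; rewrite sg_irr.
  have -> : (B \in f @: top_nbrs_below i) = (k < i).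
    apply/imsetP/idP => [[k' + e] | ki]; last by exists k => //; rewrite inE ki.
    rewrite inE => /andP[k'i _]; have : k \in f k' by rewrite -e eBk !inE eqxx.
    by rewrite !inE (negPf nkt) orbF => /eqP->.
  apply/exists_inP/idP => [[x] | ki].
    rewrite eBk !inE => /andP[/norP[xk xt]]; rewrite (negPf xt) orbF => /eqP e.
    subst x => /forall_inP/(_ k); rewrite !inE eqxx (negPf nkt) [k == i]eq_sym (negPf
      xk) /= => /(_ isT).
    by rewrite leq_eqVlt => /orP[/eqP/val_inj e|//]; rewrite e eqxx in xk.
  exists i.
    by rewrite eBk !inE eqxx (negPf nit) orbF andbT -val_eqE /= neq_ltn ki orbT.
  apply/forall_inP => y; rewrite eBk !inE.
  by case: (y == top); rewrite ?orbT ?orbF //= => /orP[] /andP[_ /eqP->] //;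
    apply: ltnW.
rewrite cardsU below_clique_card.
have -> : cliques_in H (below n.+1 n) 2 :&: f @: top_nbrs_below i = set0.
  apply/setP => B; rewrite !inE top_notin_below;
    apply/negP => /andP[/andP[topB _] /imsetP[k _ e]].
  by rewrite e !inE eqxx orbT in topB.
rewrite cards0 subn0 card_in_imset // => k k';
  rewrite !inE => /andP[ki _] /andP[k'i _] e.
have : k \in f k' by rewrite -e !inE eqxx.
rewrite !inE => /orP[/eqP // | /eqP kt].
by move: ki; rewrite kt /= ltnNge ltnW.
Qed.

Lemma colex_top (i : 'I_n.+1) :
  C top i = (i %% r != n %% r) && (#|top_nbrs_below i| < L).
Proof.
rewrite sg_sym -[i %% r != _]/(H i top) -[LHS]/(H i top && (_ < _)).
by case Hit: (H i top) => //=; rewrite colex_top_count // ltn_add2l.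
Qed.

Lemma top_nbrs_below_lt (i j : 'I_n.+1) : i < j -> i %% r != n %% r ->
  #|top_nbrs_below i| < #|top_nbrs_below j|.
Proof.
move=> ij ir; apply: proper_card; apply/properP; split.
  by apply/subsetP => k; rewrite !inE => /andP[ki ->]; rewrite (ltn_trans ki).
by exists i; rewrite !inE ?ij // ltnn.
Qed.

(** The number of earlier candidates is an injective rank on the neighbourhood,
    with values below L. *)
Lemma card_nbhd_top_le : #|nbhd C top| <= L.
Proof.
have lt i : i \in nbhd C top -> #|top_nbrs_below i| < L.
  by rewrite inE colex_top => /andP[].
have [->|/set0Pn[x0 /lt x0P]] := eqVneq (nbhd C top) set0; first by rewrite cards0.
have L0 : 0 < L by apply: leq_ltn_trans x0P.
pose g (i : 'I_n.+1) := insubd (Ordinal L0) #|top_nbrs_below i|.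
have injg : {in nbhd C top &, injective g}.
  move=> i j iN jN /(congr1 val); rewrite !insubdK ?unfold_in ?lt // => e.
  move: iN jN; rewrite !inE !colex_top => /andP[ir _] /andP[jr _].
  apply: val_inj; case: (ltngtP i j) => //= h.
    by have := top_nbrs_below_lt h ir; rewrite e ltnn.
  by have := top_nbrs_below_lt h jr; rewrite e ltnn.
by rewrite -(card_in_imset injg) -[L in _ <= L]card_ord max_card.
Qed.

Let q := r.-1.
Let c := n %% r.
(** The k-th natural number (from 0) that is not congruent to c modulo r, and
    the inverse function. *)
Let off (k : nat) := k %/ q * r + k %% q + (c <= k %% q).
Let pos (i : nat) := i %/ r * q + (i %% r - (c < i %% r)).

Let q0 : 0 < q. Proof. by rewrite /q; lia. Qed.
Let rq : r = q.+1. Proof. by rewrite /q; lia. Qed.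
Let cr : c < r. Proof. by rewrite ltn_pmod //; lia. Qed.

Lemma off_divmod k :
  off k %/ r = k %/ q /\ off k %% r = k %% q + (c <= k %% q).
Proof.
have lt : k %% q + (c <= k %% q) < r.
  by have := ltn_pmod k q0; rewrite rq; case: (c <= _); lia.
have r0 : 0 < r by lia.
by rewrite /off -addnA divnMDl // (divn_small lt) addn0 modnMDl modn_small.
Qed.

Lemma off_mod_neq k : off k %% r != c.
Proof. by have [_ ->] := off_divmod k; case: leqP => h; rewrite neq_ltn; lia. Qed.

Lemma off_mod_eq k k' : (off k %% r == off k' %% r) = (k %% q == k' %% q).
Proof.
have [_ ->] := off_divmod k; have [_ ->] := off_divmod k'.
by apply/eqP/eqP => [|->//]; case: leqP; case: leqP; lia.
Qed.

Lemma pos_off k : pos (off k) = k.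
Proof.
rewrite /pos; have [-> ->] := off_divmod k; rewrite [RHS](divn_eq k q); congr (_ + _).
by case: leqP => h; case: ltnP; lia.
Qed.

Lemma pos_lt i j : i < j -> i %% r != c -> j %% r != c -> pos i < pos j.
Proof.
move=> ij ic jc; rewrite /pos.
have ri := ltn_pmod i (ltnW r1); have rj := ltn_pmod j (ltnW r1).
move: ij; rewrite {1}(divn_eq i r) {1}(divn_eq j r) => ij.
have [lt|gt|eq] := ltngtP (i %/ r) (j %/ r).
- have le_q : (i %/ r).+1 * q <= j %/ r * q by rewrite leq_mul2r lt orbT.
  have lt_q : i %% r - (c < i %% r) < q.
    move: ri ic cr; set b := i %% r; rewrite rq => {}ri {}ic cq.
    by case: (ltngtP c b) ic => h; rewrite ?h ?eqxx //= => _; lia.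
  apply: leq_trans (leq_addr _ _); apply: leq_trans le_q.
  by rewrite mulSn [X in _ < X]addnC ltn_add2l.
- have : (j %/ r).+1 * r <= i %/ r * r by rewrite leq_mul2r gt orbT.
  by rewrite mulSn; lia.
- by rewrite eq in ij *; lia.
Qed.

(** The first L non-members of the class of the top vertex lie below 2 L <= n, so
    there is room for L neighbours. *)
Lemma off_le k : off k <= 2 * k + 1.
Proof.
rewrite /off rq mulnS; have := divn_eq k q; have := leq_div k q.
by case: (c <= _) => /=; lia.
Qed.

Lemma card_top_nbrs_below k : #|top_nbrs_below (off k)| <= k.
Proof.
case: k => [|k].
  rewrite leqn0 cards_eq0; apply/eqP/setP => i; rewrite !inE;
    apply/negP => /andP[lt ic].
  by have := pos_lt lt ic (off_mod_neq 0); rewrite pos_off.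
have lt (i : 'I_n.+1) : i \in top_nbrs_below (off k.+1) -> pos i < k.+1.
  by rewrite inE => /andP[lt ic]; have := pos_lt lt ic (off_mod_neq _); rewrite pos_off.
pose g (i : 'I_n.+1) : 'I_k.+1 := inord (pos i).
have injg : {in top_nbrs_below (off k.+1) &, injective g}.
  move=> i j iN jN /(congr1 val) /=; rewrite !inordK ?lt // => e.
  move: iN jN; rewrite !inE => /andP[_ ir] /andP[_ jr].
  apply: val_inj; case: (ltngtP i j) => //= h.
    by have := pos_lt h ir jr; rewrite e ltnn.
  by have := pos_lt h jr ir; rewrite e ltnn.
by rewrite -(card_in_imset injg) -[X in _ <= X]card_ord max_card.
Qed.

(** The enumeration of the non-members of the class of the top vertex turns
    residues modulo r into residues modulo r - 1, hence embeds T_{r-1}(L) into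
    the neighbourhood of the top vertex. *)
Lemma k_in_nbhd_top t : k_turan r.-1 L t <= k_in C (nbhd C top) t.
Proof.
have offn (k : 'I_L) : off k < n by have := off_le k; have := ltn_ord k; lia.
pose g (k : 'I_L) : 'I_n.+1 := Ordinal (ltn_trans (offn k) (ltnSn n)).
have injg : injective g.
  by move=> k k' /(congr1 val) /= /(congr1 pos); rewrite !pos_off => /val_inj.
have Cg k k' : C (g k) (g k') = turan q L k k'.
  by rewrite colex_below //= /turan_rel /= off_mod_eq.
rewrite /k_turan -k_in_setT -/q -(k_in_imset setT t injg Cg); apply: k_inS.
apply/subsetP => _ /imsetP[k _ ->]; rewrite inE colex_top off_mod_neq /=.
by apply: leq_ltn_trans (card_top_nbrs_below k) _.
Qed.

Lemma card_nbhd_top : #|nbhd C top| = L.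
Proof.
apply/eqP; rewrite eqn_leq card_nbhd_top_le -(k_in1 C).
by apply: leq_trans (k_in_nbhd_top 1);
  rewrite /k_turan -k_in_setT k_in1 cardsT card_ord.
Qed.

Lemma k_in_colex_turan t : num_cliques C t.+1
  = k_turan r n t.+1 + k_in C (nbhd C top) t.
Proof.
rewrite -k_in_setT (k_in_setD1 _ _ (in_setT top)) setTI; congr (_ + _).
have -> : [set: 'I_n.+1] :\ top = below n.+1 n.
  apply/eqP; rewrite eqEsubset top_notin_below !inE eqxx /=.
  by apply/subsetP => x; rewrite !inE andbT; apply: contraTneq => ->; rewrite ltnn.
rewrite -(k_in_below r t.+1 (leqnSn n)); apply: k_in_eq_in => i j.
by rewrite !inE => iN jN; apply: colex_below.
Qed.

Lemma colex_turan_clique_free : clique_free C r.+1.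
Proof.
move=> A clA cA; have : #|A| <= r; last by rewrite cA ltnn.
apply: (@turan_clique_card r n.+1); first by lia.
apply/is_cliqueP => x y xA yA nxy; move/is_cliqueP: clA => /(_ x y xA yA nxy).
by rewrite /= /colex_turan_rel => /andP[].
Qed.

Lemma num_edges_colex_turan : num_edges C = E + L.
Proof. by rewrite num_edgesE k_in_colex_turan k_in1 card_nbhd_top /E num_edgesE. Qed.

End ColexTuran.

(** * Uniqueness of the extremal graph in Turan's theorem *)

Section Colorings.
Variable V : finType.
Implicit Types (c : V -> nat) (A : {set V}).

Definition color_rel c : rel V := fun x y => c x != c y.
Fact color_sym c : symmetric (color_rel c).
Proof. by move=> x y; rewrite /color_rel eq_sym. Qed.
Fact color_irr c : irreflexive (color_rel c).
Proof. by move=> x; rewrite /color_rel eqxx. Qed.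
Definition multipartite c : sgraph V := SGraph (@color_sym c) (@color_irr c).
Definition color_class c i : {set V} := [set x | c x == i].

Lemma multipartite_clique_card c r A : {in A, forall x, c x < r} ->
  is_clique (multipartite c) A -> #|A| <= r.
Proof.
move=> cr /is_cliqueP clA; case: r cr => [|r] cr.
  rewrite leqn0 cards_eq0; apply/eqP/setP => x; rewrite inE.
  by apply/negP => /cr.
pose f x : 'I_r.+1 := inord (c x).
have injf : {in A &, injective f}.
  move=> x y xA yA /(congr1 val) /=; rewrite !inordK ?cr // => e.
  apply: contraTeq isT => nxy.
  by have := clA _ _ xA yA nxy; rewrite /= /color_rel e eqxx.
by rewrite -(card_in_imset injf) -[X in _ <= X]card_ord max_card.
Qed.

(** Erdos's proof of Turan's theorem. Let N be the neighbourhood of a vertex of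
    maximum degree; color N by induction with r - 1 colors and give all other
    vertices the remaining color. Equality forces every vertex outside N to be
    joined to all of N and to nothing else. *)
Lemma erdos_majorization (G : sgraph V) r A :
  (forall C : {set V}, C \subset A -> is_clique G C -> #|C| <= r) ->
  exists c, [/\ {in A, forall x, c x < r}, k_in G A 2 <= k_in (multipartite c) A 2
    & k_in G A 2 = k_in (multipartite c) A 2 -> {in A &, G =2 multipartite c}].
Proof.
elim: r A => [|r IH] A Afree.
  have A0 : A = set0.
    apply/setP => x; rewrite inE; apply/negP => xA.
    suff : #|[set x]| <= 0 by rewrite cards1.
    apply: Afree; first by rewrite sub1set.
    by apply/is_cliqueP => u v /set1P-> /set1P->; rewrite eqxx.
  by exists (fun _ => 0); rewrite A0 !k_in_set0; split=> // [x|_ x y]; rewrite inE.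
have [->|/set0Pn[x0 x0A]] := eqVneq A set0.
  by exists (fun _ => 0); rewrite !k_in_set0; split=> // _ x y; rewrite inE.
pose v := [arg max_(v > x0 in A) #|A :&: nbhd G v|].
have [vA maxv] : v \in A /\ {in A, forall u, #|A :&: nbhd G u| <= #|A :&: nbhd G v|}.
  by rewrite /v; case: arg_maxnP.
set N := A :&: nbhd G v in maxv; set S := A :\: N.
have NA : N \subset A by apply: subsetIl.
have eA : A = S :|: N by rewrite -{1}(setID A N) setUC (setIidPr NA).
have dSN : [disjoint S & N] by rewrite -setI_eq0 setIDAC -setIDA setDv setI0.
have [C CN clC|c [cr le eqG]] := IH N.
  have : #|v |: C| <= r.+1.
    apply: Afree; first by rewrite subUset sub1set vA (subset_trans CN).
    have vC y : y \in C -> G v y by move/(subsetP CN); rewrite !inE => /andP[].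
    apply/is_cliqueP => x y; rewrite !inE => /orP[/eqP->|xC] /orP[/eqP->|yC].
    - by rewrite eqxx.
    - by move=> _; apply: vC.
    - by move=> _; rewrite sg_sym; apply: vC.
    - by move/is_cliqueP: clC; apply.
  rewrite cardsU1 (_ : v \notin C) //.
  by apply/negP => /(subsetP CN); rewrite !inE sg_irr andbF.
pose c' x := if x \in N then c x else r.
have c'N : {in N, forall x, c' x = c x} by move=> x; rewrite /c' => ->.
have c'S : {in S, forall x, c' x = r}.
  by move=> x xS; rewrite /c' (disjointFr dSN xS).
have c'N2 : {in N &, multipartite c =2 multipartite c'}.
  by move=> x y xN yN; rewrite /= /color_rel !c'N.
have c'SN x y : x \in S -> y \in N -> multipartite c' x y.
  by move=> xS yN; rewrite /= /color_rel c'S // c'N // eq_sym neq_ltn cr.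
have c'SS x y : x \in S -> y \in S -> multipartite c' x y = false.
  by move=> xS yS; rewrite /= /color_rel !c'S // eqxx.
have edges' : 2 * k_in (multipartite c') A 2
  = 2 * k_in (multipartite c) N 2 + \sum_(x in S) (#|N| + #|N|).
  rewrite {1}eA edges_delete_set // (k_in_eq_in _ c'N2); congr (_ + _).
  apply: eq_bigr => x xS.
  have NN : N :&: nbhd (multipartite c') x = N.
    by apply/setIidPl/subsetP => y yN; rewrite inE; apply: c'SN.
  rewrite setIUl NN (_ : S :&: _ = set0) ?set0U //.
  apply/setP => y; rewrite !in_setI [y \in nbhd _ _]inE [RHS]inE.
  by apply/andP => -[yS]; rewrite c'SS.
have edgesG := edges_delete_set G dSN; rewrite -eA in edgesG.
have SA x : x \in S -> x \in A by rewrite inE => /andP[].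
have degS x : x \in S -> #|A :&: nbhd G x| + #|N :&: nbhd G x| <= #|N| + #|N|.
  move=> xS; apply: leq_add; first exact: maxv (SA _ xS).
  by rewrite subset_leq_card ?subsetIl.
exists c'; split.
- move=> x; rewrite {1}eA inE => /orP[xS|xN]; first by rewrite c'S.
  by rewrite c'N // ltnW // ltnS cr.
- rewrite -(@leq_pmul2l 2) // edges' edgesG leq_add ?leq_mul2l //.
  exact: leq_sum.
move=> eq2; move: edges'; rewrite -eq2 edgesG => e.
have leS : \sum_(x in S) (#|A :&: nbhd G x| + #|N :&: nbhd G x|)
  <= \sum_(x in S) (#|N| + #|N|).
  exact: leq_sum.
have eN : k_in G N 2 = k_in (multipartite c) N 2 by lia.
have {}eqG := eqG eN.
have eS : \sum_(x in S) (#|A :&: nbhd G x| + #|N :&: nbhd G x|)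
  == \sum_(x in S) (#|N| + #|N|).
  by apply/eqP; lia.
have degE x : x \in S -> #|A :&: nbhd G x| + #|N :&: nbhd G x| = #|N| + #|N|.
  move=> xS; move: eS; rewrite (leqif_sum (E2 := fun x => #|N| + #|N|)
     (C := fun x => #|A :&: nbhd G x| + #|N :&: nbhd G x| == #|N| + #|N|)); last first.
    by move=> i iS; split=> //; apply: degS.
  by move/forall_inP/(_ x xS)/eqP.
have NG x : x \in S -> N :&: nbhd G x = N /\ A :&: nbhd G x = N.
  move=> xS; have := degE x xS; have := maxv x (SA x xS).
  have le1 : N :&: nbhd G x \subset N by apply: subsetIl.
  have := subset_leq_card le1 => h1 h2 h3.
  have e1 : N :&: nbhd G x = N by apply/eqP; rewrite eqEcard le1; lia.
  split=> //; apply/eqP; rewrite eq_sym eqEcard -{1}e1 setSI //=; lia.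
have GSN x y : x \in S -> y \in N -> G x y.
  by move=> xS; have [<- _] := NG x xS; rewrite !inE => /andP[].
have GSS x y : x \in S -> y \in S -> G x y = false.
  move=> xS yS; apply/negP => Gxy; have [_ e1] := NG x xS.
  have : y \in A :&: nbhd G x by rewrite in_setI (SA _ yS) inE.
  by rewrite e1 (disjointFr dSN yS).
move=> x y; rewrite eA !in_setU => /orP[xS|xN] /orP[yS|yN].
- by rewrite GSS ?c'SS.
- by rewrite GSN ?c'SN.
- by rewrite [RHS]sg_sym sg_sym GSN ?c'SN.
- by rewrite eqG ?c'N2.
Qed.

Lemma multipartite_edges_le c r : (forall x, c x < r) ->
  num_cliques (multipartite c) 2 <= k_turan r #|V| 2.
Proof.
move=> cr; rewrite -k_in_setT -cardsT; apply: zykov => C _.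
by apply: multipartite_clique_card => x _.
Qed.

Definition balanced r c := forall i j, i < r -> j < r ->
  #|color_class c i| <= #|color_class c j| + 1.

(** Moving a vertex from a class to one smaller by at least two would gain edges. *)
Lemma extremal_balanced c r : (forall x, c x < r) ->
  num_cliques (multipartite c) 2 = k_turan r #|V| 2 -> balanced r c.
Proof.
move=> cr ext i j ir jr; rewrite leqNgt; apply/negP => lt.
have /card_gt0P[x] : 0 < #|color_class c i| by lia.
rewrite inE => /eqP cx.
have nij : j != i by apply: contraTneq lt => ->; lia.
pose c' y := if y == x then j else c y.
have c'r y : c' y < r by rewrite /c'; case: eqP.
have := multipartite_edges_le c'r; rewrite -ext -!k_in_setT.
rewrite !(k_in_setD1 _ _ (in_setT x)) !setTI !k_in1.
have -> : k_in (multipartite c') ([set: V] :\ x) 2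
  = k_in (multipartite c) ([set: V] :\ x) 2.
  apply: k_in_eq_in => y z; rewrite !inE !andbT /= /color_rel /c'.
  by move=> /negPf-> /negPf->.
have -> : nbhd (multipartite c) x = ~: color_class c i.
  by apply/setP => y; rewrite !inE /= /color_rel cx eq_sym.
have -> : nbhd (multipartite c') x = ~: (x |: color_class c j).
  apply/setP => y; rewrite !inE /= /color_rel /c' eqxx.
  by case: (y =P x) => [->|_] /=; rewrite ?eqxx // eq_sym.
have := cardsC (color_class c i); have := cardsC (x |: color_class c j).
rewrite cardsU1 inE cx eq_sym nij; lia.
Qed.

Lemma sum_color_class c r : (forall x, c x < r) ->
  \sum_(i < r) #|color_class c i| = #|V|.
Proof.
move=> cr; rewrite -sum1_card (partition_big (fun x => Ordinal (cr x)) predT) //=.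
apply: eq_bigr => i _; rewrite -sum1_card; apply: eq_bigl => x.
by rewrite inE -val_eqE.
Qed.

(** Every class has the minimal size or one more, and the minimum is attained, so
    Euclidean division of |V| by r determines how many classes of each size
    there are. *)
Lemma balanced_class_sizes c r : (forall x, c x < r) -> balanced r c -> 0 < r ->
  perm_eq [seq #|color_class c i| | i <- iota 0 r]
    (nseq (#|V| %% r) (#|V| %/ r).+1 ++ nseq (r - #|V| %% r) (#|V| %/ r)).
Proof.
move=> cr bal r0; pose a i := #|color_class c i|.
pose i0 := [arg min_(i < Ordinal r0) a i].
have minP (j : 'I_r) : a i0 <= a j by rewrite /i0; case: arg_minnP => // i _; apply.
have range i : i < r -> a i = a i0 + (a i != a i0).
  move=> ir; have := minP (Ordinal ir); have := bal i i0 ir (ltn_ord i0);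
    rewrite -!/(a _) /=.
  by case: eqP; lia.
set k := \sum_(i < r) (a i != a i0).
have sumk : #|V| = r * a i0 + k.
  rewrite -(sum_color_class cr) /k -[r in r * _]card_ord -sum_nat_const -big_split /=.
  by apply: eq_bigr => i _; apply: range.
have kr : k < r.
  rewrite -[X in _ < X]card_ord -sum1_card /k (bigD1 i0) //=.
  rewrite [X in _ < X](bigD1 i0) //= eqxx add0n add1n ltnS.
  by apply: leq_sum => i _; case: (_ != _).
have -> : #|V| %/ r = a i0 by rewrite sumk mulnC divnMDl // (divn_small kr) addn0.
have -> : #|V| %% r = k by rewrite sumk mulnC modnMDl modn_small.
have ksum : count (fun i => a i != a i0) (iota 0 r) = k.
  rewrite -sum1_count big_mkcond /k -(big_mkord xpredT (fun i => (a i != a i0) :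
    nat)) /index_iota subn0.
  by apply: eq_bigr => i _; case: (_ != _).
have kcount : count (fun i => a i == a i0) (iota 0 r) = r - k.
  have := count_predC (fun i => a i == a i0) (iota 0 r); rewrite size_iota.
  by rewrite [count (predC _) _](_ : _ = k) //; lia.
apply/allP => y _; rewrite /= count_cat !count_nseq count_map /=.
have [->|ny] := eqVneq y (a i0).
  rewrite (_ : (_.+1 == _) = false) ?mul0n ?add0n ?mul1n; last by apply/negbTE; lia.
  by rewrite -kcount; apply/eqP; apply: eq_count.
have [->|ny'] := eqVneq y (a i0).+1.
  rewrite mul0n addn0 mul1n -ksum; apply/eqP; apply: eq_in_count => i;
    rewrite mem_iota /= => ir.
  by rewrite -/(a i); have := range i ir; case: eqP; case: eqP; lia.
rewrite !mul0n addn0; apply/eqP; rewrite -[RHS](count_pred0 (iota 0 r)).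
apply: eq_in_count => i.
rewrite mem_iota /= => ir; apply/negbTE/negP; rewrite -/(a i) => /eqP e.
by have := range i ir; rewrite e; case: eqP ny ny' => [->|_] /=;
  rewrite ?eqxx // => _; rewrite addn1 => /eqP.
Qed.

End Colorings.

(** Balanced colorings have the same class sizes up to a permutation s of the
    colors; match the k-th vertex of class i with the k-th vertex of class s i. *)
Lemma balanced_bijection (V W : finType) r (c : V -> nat) (d : W -> nat) :
  0 < r -> 0 < #|V| -> #|V| = #|W| ->
  (forall x, c x < r) -> (forall y, d y < r) -> balanced r c -> balanced r d ->
  exists2 f : V -> W, bijective f & forall x y, (d (f x) == d (f y)) = (c x == c y).
Proof.
move=> r0 V0 eVW cr dr balc bald.
have [w0 _] : exists w0 : W, w0 \in [set: W] by apply/card_gt0P; rewrite cardsT -eVW.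
have := balanced_class_sizes cr balc r0; rewrite perm_sym eVW => perm_c.
have := perm_trans (balanced_class_sizes dr bald r0) perm_c; rewrite perm_sym.
case/(perm_iotaP 0) => Is; rewrite size_map size_iota => permI eI.
have sI : size Is = r by rewrite (perm_size permI) size_iota.
have uI : uniq Is by rewrite (perm_uniq permI) iota_uniq.
pose s i := nth 0 Is i.
have sr i : i < r -> s i < r.
  move=> ir; have : s i \in Is by rewrite mem_nth ?sI.
  by rewrite (perm_mem permI) mem_iota.
have class_s i : i < r -> #|color_class d (s i)| = #|color_class c i|.
  move=> ir; have /(congr1 (nth 0 ^~ i)) := eI.
  rewrite (nth_map 0) ?size_iota // nth_iota // add0n => ->.
  by rewrite (nth_map 0) ?sI // (nth_map 0) ?size_iota ?nth_iota ?sr.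
pose f x := nth w0 (enum (color_class d (s (c x))))
                   (index x (enum (color_class c (c x)))).
have idx x : index x (enum (color_class c (c x)))
  < size (enum (color_class d (s (c x)))).
  by rewrite -cardE class_s // cardE index_mem mem_enum inE.
have df x : d (f x) = s (c x).
  by have := mem_nth w0 (idx x); rewrite -/(f x) mem_enum inE => /eqP.
have dfE x y : (d (f x) == d (f y)) = (c x == c y).
  by rewrite !df nth_uniq ?sI.
have injf : injective f.
  move=> x y exy; have /eqP cxy : c x == c y by rewrite -dfE exy.
  have := idx y; have := idx x; move: exy; rewrite /f cxy => e ix iy.
  have /eqP := e; rewrite nth_uniq ?enum_uniq // => /eqP e'.
  have xin : x \in enum (color_class c (c y)) by rewrite mem_enum inE cxy.
  by rewrite -(nth_index x xin) e' nth_index // mem_enum inE.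
by exists f => //; apply: inj_card_bij; rewrite // eVW.
Qed.

(** The majorizing coloring and the residues modulo r both give extremal, hence
    balanced, complete multipartite graphs. *)
Theorem turan_unique (V : finType) (G : sgraph V) r n :
  0 < r -> 0 < n -> #|V| = n -> clique_free G r.+1 -> num_cliques G 2 = k_turan r n 2 ->
  isomorphic G (turan r n).
Proof.
move=> r0 n0 cV Gfree ext.
have [C _|c [cr le eqG]] := @erdos_majorization _ G r setT;
  first exact: clique_free_card.
have {}cr x : c x < r by apply: cr; rewrite inE.
rewrite k_in_setT k_in_setT in le eqG.
have extc : num_cliques (multipartite c) 2 = k_turan r #|V| 2.
  by apply/eqP; rewrite eqn_leq multipartite_edges_le //= cV -ext.
have {}eqG : {in setT &, G =2 multipartite c} by apply: eqG; rewrite ext extc cV.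
have dr (i : 'I_n) : i %% r < r by rewrite ltn_pmod.
have extd : num_cliques (multipartite (fun i : 'I_n => i %% r)) 2 = k_turan r #|'I_n| 2.
  by rewrite card_ord.
have [||f bijf fE] := @balanced_bijection V 'I_n r c (fun i => i %% r) r0 _ _ cr dr
  (extremal_balanced cr extc) (extremal_balanced dr extd).
- by rewrite cV.
- by rewrite cV card_ord.
exists f => // x y; rewrite eqG ?inE //= /turan_rel /color_rel fE.
by [].
Qed.

(** * Graphs with one low-degree vertex, and the final comparison *)

Lemma isomorphic_num_cliques (V W : finType) (G : sgraph V) (H : sgraph W) t :
  isomorphic G H -> num_cliques G t = num_cliques H t.
Proof.
case=> f [g fK gK] fH; rewrite -!k_in_setT -(k_in_imset setT t (can_inj fK) fH).
congr (k_in _ _ _); apply/setP => y; rewrite inE; apply/imsetP.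
by exists (g y); rewrite ?gK.
Qed.

Lemma num_cliques_induced (V : finType) (G : sgraph V) (A : {set V}) t :
  num_cliques (induced G A) t = k_in G A t.
Proof.
rewrite -k_in_setT -(@k_in_imset _ _ _ G val setT t val_inj) //.
congr (k_in _ _ _); apply/setP => x; apply/imsetP/idP => [[y _ ->]|xA].
  exact: valP y.
by exists (Sub x xA); rewrite ?inE.
Qed.

(** For j = 1. The vertex v and the rest of the graph contribute separately, so
    equality in the sum forces equality in both terms. *)
Lemma one_low_degree_vertex (V : finType) (G : sgraph V) r n L v :
  0 < r -> 0 < n -> #|V| = n.+1 -> clique_free G r.+1 -> deg G v <= L ->
  (forall t, num_cliques G t.+1 <= k_turan r n t.+1 + k_turan r.-1 L t)
  /\ (num_cliques G 2 = k_turan r n 2 + L ->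
      isomorphic (induced G [set~ v]) (turan r n) /\ deg G v = L).
Proof.
move=> r0 n0 cV Gfree dv.
have cv : #|[set~ v]| = n by rewrite cardsC1 cV.
split=> [t|eqG].
  have := @k_in_low_degree _ G r [set v] L t Gfree; rewrite cards1 mul1n cv; apply.
  by move=> u /set1P->.
have le : k_in G [set~ v] 2 <= k_turan r n 2.
  by rewrite -cv; apply: zykov => C _; apply: clique_free_card.
have := k_in_setD1 G 1 (in_setT v); rewrite k_in_setT eqG setTI k_in1 setTD => e.
have -> : deg G v = L by rewrite /deg -/(nbhd G v) in dv *; lia.
split=> //; apply: turan_unique => //.
- by rewrite card_sig -cv; apply: eq_card => x; rewrite !inE.
- move=> A clA cA; have [|] := Gfree (val @: A);
    last by rewrite card_imset //; apply: val_inj.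
  apply/is_cliqueP => _ _ /imsetP[x xA ->] /imsetP[y yA ->] nxy.
  by move/is_cliqueP: clA; apply=> //; apply: contra nxy => /eqP->.
- rewrite num_cliques_induced; move: e dv; rewrite /deg -/(nbhd G v); lia.
Qed.

Local Open Scope ring_scope.

Theorem theorem1p6 (l : int) (r : nat) (hl : -1 <= l) (hr : (3 <= r)%N) :
  exists N : nat, forall n : nat, (N <= n)%N ->
    [/\ (num_edges (Gstar l n r))%:Z
          = (num_edges (turan r n.-1))%:Z + (l + 1),
        clique_free (Gstar l n r) r.+1 /\ degree_condition l n (Gstar l n r)
      & forall (V : finType) (G : sgraph V),
          #|V| = n -> clique_free G r.+1 -> degree_condition l n G ->
          [/\ (num_edges G <= num_edges (Gstar l n r))%N,
              forall t : nat, (2 <= t)%N ->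
                (num_cliques G t <= num_cliques (Gstar l n r) t)%N,
              isomorphic G (Gstar l n r) ->
                num_edges G = num_edges (Gstar l n r) /\
                forall t : nat, (2 <= t)%N ->
                  num_cliques G t = num_cliques (Gstar l n r) t
            & num_edges G = num_edges (Gstar l n r) ->
                Gfamily l n r G \/ Hfamily l n r G]].
Proof.
pose L := `|(l + 1)%R|%N; have eL : l + 1 = L%:Z by rewrite /L; lia.
pose B := (4 * (r * L) + 2 * r + 2 * r ^ 2 + 1000 * L.+2)%N.
(* The factor 2 gives n - j >= B, because j <= n/2. *)
exists (2 * B + 2)%N => -[|n] nB; first by lia.
have r0 : (0 < r)%N by lia.
have r1 : (1 < r)%N by lia.
have BL : (1000 * L.+2 <= B)%N by rewrite /B; lia.
have Ln : (2 * L <= n)%N by lia.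
rewrite /Gstar -/L [n.+1.-1]/=.
set C := colex_turan _ _ _.
have edgesC : num_edges C = (num_edges (turan r n) + L)%N :=
  num_edges_colex_turan r1 Ln.
have cliquesC t : num_cliques C t.+1 = (k_turan r n t.+1 + k_in C (nbhd C ord_max) t)%N.
  exact: k_in_colex_turan.
have Cge t : (k_turan r n t.+1 + k_turan r.-1 L t <= num_cliques C t.+1)%N.
  by rewrite cliquesC leq_add2l k_in_nbhd_top.
split.
- by rewrite edgesC eL.
- split; first exact: colex_turan_clique_free.
  exists 1%N; split=> //; first by lia.
  have := sorted_deg1_le C ord_max; rewrite /deg -/(nbhd C _) card_nbhd_top //; lia.
move=> V G cV Gfree [j [j1 jn dj]].
have edgesE : num_edges C = (k_turan r n 2 + L)%N by rewrite edgesC num_edgesE.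
have [S cS degS] : exists2 S : {set V},
    #|S| = j & {in S, forall v, deg G v <= j.-1 + L}%N.
  by apply: low_degree_set; [rewrite cV; lia | lia].
have iso_eq : isomorphic G C -> num_edges G = num_edges C /\
    forall t : nat, (2 <= t)%N -> num_cliques G t = num_cliques C t.
  by move=> iso; rewrite !num_edgesE; split=> [|t _]; apply: isomorphic_num_cliques.
have [j_eq1|j_gt1] := eqVneq j 1%N.
  rewrite {j j1 jn dj}j_eq1 in cS degS.
  have /eqP/cards1P[v eS] := cS.
  have dv : (deg G v <= L)%N by apply: degS; rewrite eS inE.
  have [|bound uniq] := one_low_degree_vertex r0 _ cV Gfree dv; first by lia.
  have cl t : (2 <= t)%N -> (num_cliques G t <= num_cliques C t)%N.
    by case: t => // t _; apply: leq_trans (bound t) (Cge t).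
  split=> //; first by rewrite !num_edgesE cl.
  rewrite edgesE num_edgesE => /uniq[iso eqd]; left; split=> //.
  by exists v; rewrite eqd eL.
have cCS : #|~: S| = (n.+1 - j)%N by have := cardsC S; rewrite cV cS; lia.
have [|||||bound strict] :=
  @low_degree_set_bound V G r L j.-1 (n.+1 - j) S _ Gfree _ cCS _ _ _ degS.
- by [].
- by rewrite cS; lia.
- by lia.
- by lia.
- by rewrite -/B; lia.
rewrite (_ : (n.+1 - j + j.-1)%N = n) in bound strict; last by lia.
have lt : (num_edges G < num_edges C)%N.
  by rewrite num_edgesE edgesE; apply: leq_trans strict (leq_addr _ _).
split=> //; first exact: ltnW.
  case=> [|[|t]] // _; apply: leq_trans (bound t.+1 isT) (leq_trans (leq_addr _ _)
    (Cge _)).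
by move=> e; rewrite e ltnn in lt.
Qed.
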